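(* Let $s\in(0,1)$, let $p$ satisfy conditions $(\mathrm P_1)$ and $(\mathrm P_2)$ stated in the context, with $m\in(0,1)$ the constant in $(\mathrm P_1)$. Let $\lambda\in\mathbb{R}$ and let $\Omega_\lambda=H_\lambda\cap B_1(0)$ be a bounded domain in $H_\lambda$. Let $u\in C^{1,1}_{loc}(\mathbb{R}^N)\cap L_{sp(x,\cdot)}$ be lower semi-continuous on $\overline{B}_1(0)$, with values $u(x)\in(0,m)$, and such that $$(-\Delta)^s_{p(x,\cdot)}u_\lambda(x)-(-\Delta)^s_{p(x,\cdot)}u(x)\ge 0\quad\text{for } x\in B_1(0),\qquad w_\lambda(x)\ge 0\quad\text{for } x\in H_\lambda\setminus B_1(0).$$ Then $w_\lambda(x)\ge 0$ for all $x\in H_\lambda$. Moreover, if $w_\lambda(x)=0$ at some point $x\in\Omega_\lambda$, then $w_\lambda=0$ almost everywhere in $\mathbb{R}^N$.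
   Context: $B_1(0)=\{x\in\mathbb{R}^N:|x|<1\}$. For $\lambda\in\mathbb{R}$: $T_\lambda=\{x\in\mathbb{R}^N: x_1=\lambda\}$, $H_\lambda=\{x\in\mathbb{R}^N: x_1<\lambda\}$, $x_\lambda=(2\lambda-x_1,x_2,\dots,x_N)$ is the reflection of $x$ about $T_\lambda$, $u_\lambda(x)=u(x_\lambda)$, and $w_\lambda(x)=u_\lambda(x)-u(x)$. Conditions on the exponent. $(\mathrm P_1)$: $p:\mathbb{R}^{2N}=\mathbb{R}^N\times\mathbb{R}^N\to(2,+\infty)$ is continuous, with $1-\frac{1}{\ln(m)}<p^-:=\min_{(x,y)\in\mathbb{R}^{2N}}p(x,y)\le p(x,y)\le p^+:=\max_{(x,y)\in\mathbb{R}^{2N}}p(x,y)$ for some $0<m<1$, and $sp^+<N$. $(\mathrm P_2)$: there is a continuous function $Q:\mathbb{R}_+\to\mathbb{R}_+$ such that $p(x,y)=Q(|x-y|)$ for all $(x,y)\in\mathbb{R}^{2N}$, $Q$ is nondecreasing, and $t\mapsto t^{Q(t)}$ is increasing on $\mathbb{R}_+$. The fractional $p(x,\cdot)$-Laplacian is $$(-\Delta)^s_{p(x,\cdot)}u(x)=\text{p.v.}\int_{\mathbb{R}^N}\frac{|u(x)-u(y)|^{p(x,y)-2}(u(x)-u(y))}{|x-y|^{N+sp(x,y)}}\,dy,$$ where p.v. denotes the Cauchy principal value, i.e. the limit as $\epsilon\to0^+$ of the integrals over $\mathbb{R}^N\setminus B_\epsilon(x)$. The notation $u\in L_{sp(x,\cdot)}$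 means $u\in L^1_{loc}(\mathbb{R}^N)$ and $\int_{\mathbb{R}^N}\frac{|u(y)|^{p(x,y)-1}}{1+|y|^{N+sp(x,y)}}\,dy<\infty$ (for every $x\in\mathbb{R}^N$). $C^{1,1}_{loc}(\mathbb{R}^N)$ is the space of $C^1$ functions with locally Lipschitz gradient. *)

(* Defs.v *)
From HB Require Import structures.
From mathcomp Require Import all_boot all_order all_algebra.
From mathcomp Require Import all_classical all_reals all_analysis.

Set Implicit Arguments.
Unset Strict Implicit.
Unset Printing Implicit Defensive.

Import Order.TTheory GRing.Theory Num.Theory.
Import numFieldTopology.Exports numFieldNormedType.Exports.

Local Open Scope classical_set_scope.
Local Open Scope ring_scope.

(* The sigma-algebra on ['rV[R]_n] is the product one, generated by the
   coordinates; since R is second countable it is the Borel sigma-algebra of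
   the library's topology on row vectors. *)
Definition rV_display : measure_display.
Proof. exact: default_measure_display. Qed.

Section measurable_rV.
Context {R : realType} (n : nat).

Let coors : 'I_n -> 'rV[R]_n -> measurableTypeR R := fun i x => x ord0 i.

Let rV_set0 : g_sigma_preimage coors set0.
Proof. exact: sigma_algebra0. Qed.

Let rV_setC A : g_sigma_preimage coors A -> g_sigma_preimage coors (~` A).
Proof. exact: sigma_algebraC. Qed.

Let rV_bigcup (F : _^nat) : (forall i, g_sigma_preimage coors (F i)) ->
  g_sigma_preimage coors (\bigcup_i (F i)).
Proof. exact: sigma_algebra_bigcup. Qed.

HB.instance Definition _ := @isMeasurable.Build rV_display
  'rV[R]_n (g_sigma_preimage coors) rV_set0 rV_setC rV_bigcup.

Lemma measurable_rV_coord (i : 'I_n) :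
  measurable_fun [set: 'rV[R]_n] (fun x => x ord0 i : measurableTypeR R).
Proof.
move=> _ Y mY; rewrite setTI; apply: sub_sigma_algebra => /=.
rewrite -bigcup_seq/=; exists i => /=; first by rewrite mem_index_enum.
by exists Y => //; rewrite setTI.
Qed.

Lemma measurable_fun_rVP d (T : measurableType d) (f : T -> 'rV[R]_n) :
  (forall i, measurable_fun [set: T] (fun t => f t ord0 i : measurableTypeR R)) ->
  measurable_fun [set: T] f.
Proof.
move=> mf.
suff h : g_sigma_preimage (fun i => coors i \o f) `<=` measurable.
  move=> _ A mA; rewrite setTI; apply: h; rewrite g_sigma_preimage_comp.
  by exists A => //; rewrite setTI.
apply: smallest_sub; first exact: sigma_algebra_measurable.
rewrite -bigcup_seq; apply: bigcup_sub => i _.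
by move=> A [B mB <-]; exact: mf.
Qed.

End measurable_rV.

Section lebesgue_rV.
Context {R : realType}.

Definition rV_cons n (z : measurableTypeR R * 'rV[R]_n) : 'rV[R]_n.+1 :=
  \row_i (if unlift ord0 i is Some j then z.2 ord0 j else z.1).

Definition rV_uncons n (x : 'rV[R]_n.+1) : measurableTypeR R * 'rV[R]_n :=
  (x ord0 ord0, \row_j x ord0 (lift ord0 j)).

Lemma rV_consK n : cancel (@rV_cons n) (@rV_uncons n).
Proof.
move=> [a v]; rewrite /rV_uncons mxE unlift_none; congr pair.
by apply/rowP => j; rewrite !mxE liftK.
Qed.

Lemma rV_unconsK n : cancel (@rV_uncons n) (@rV_cons n).
Proof.
move=> x; apply/rowP => i; rewrite mxE.
by case: unliftP => [j|] -> //=; rewrite mxE.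
Qed.

Lemma measurable_rV_cons n : measurable_fun setT (@rV_cons n).
Proof.
apply: measurable_fun_rVP => i; under eq_fun do rewrite mxE.
case: (unlift ord0 i) => [j|]; last exact: measurable_fst.
exact: measurableT_comp (measurable_rV_coord j) measurable_snd.
Qed.

Lemma measurable_rV_uncons n : measurable_fun setT (@rV_uncons n).
Proof.
apply/measurable_fun_pairP; split; first exact: measurable_rV_coord.
apply: measurable_fun_rVP => j /=; under eq_fun do rewrite mxE.
exact: measurable_rV_coord.
Qed.

Section step.
Context n (mu : {sigma_finite_measure set 'rV[R]_n -> \bar R}).

Definition lebesgue_rV_step : set 'rV[R]_n.+1 -> \bar R :=
  pushforward (lebesgue_measure \x mu)%E (@rV_cons n).

Let step0 : (lebesgue_rV_step set0 = 0)%E.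
Proof. by rewrite /lebesgue_rV_step /pushforward preimage_set0 measure0. Qed.

Let step_ge0 A : (0 <= lebesgue_rV_step A)%E.
Proof. by rewrite /lebesgue_rV_step /pushforward; exact: measure_ge0. Qed.

Let step_sigma_additive : semi_sigma_additive lebesgue_rV_step.
Proof.
move=> F mF tF mUF; rewrite /lebesgue_rV_step /pushforward preimage_bigcup.
have mcons A : measurable A -> measurable (@rV_cons n @^-1` A).
  by move=> mA; rewrite -[X in measurable X]setTI; exact: measurable_rV_cons.
apply: measure_semi_sigma_additive.
- by move=> k; exact: mcons.
- apply/trivIsetP => /= i j _ _ ij; rewrite -preimage_setI.
  by move/trivIsetP : tF => /(_ _ _ _ _ ij) ->//; rewrite preimage_set0.
- by rewrite -preimage_bigcup; exact: mcons.
Qed.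

HB.instance Definition _ := isMeasure.Build _ _ _ lebesgue_rV_step
  step0 step_ge0 step_sigma_additive.

Let step_sigma_finite : sigma_finite setT lebesgue_rV_step.
Proof.
have /sigma_finiteP[F [FT ndF Foo]] := sigma_finiteT (@lebesgue_measure R).
have /sigma_finiteP[G [GT ndG Goo]] := sigma_finiteT mu.
exists (fun k => @rV_uncons n @^-1` (F k `*` G k)) => [|k].
  rewrite -preimage_bigcup (_ : \bigcup_k _ = setT) ?preimage_setT//.
  rewrite -setXTT FT GT predeqE => -[x y]; split.
    by move=> [k _ []/= ? ?]; split; exists k.
  move=> [/= [k _ Fkx] [l _ Gly]]; exists (maxn k l) => //; split.
  - by move: x Fkx; exact/subsetPset/ndF/leq_maxl.
  - by move: y Gly; exact/subsetPset/ndG/leq_maxr.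
have [mF Fk] := Foo k; have [mG Gk] := Goo k; split.
  rewrite -[X in measurable X]setTI; apply: measurable_rV_uncons => //.
  exact: measurableX.
rewrite /lebesgue_rV_step /pushforward -comp_preimage.
rewrite (_ : _ \o _ = id); last by apply/funext => z /=; rewrite rV_consK.
by rewrite preimage_id product_measure1E// lte_mul_pinfty// ge0_fin_numE.
Qed.

HB.instance Definition _ := Measure_isSigmaFinite.Build _ _ _ lebesgue_rV_step
  step_sigma_finite.

End step.

(* The n-fold product of the one-dimensional Lebesgue measure. *)
Fixpoint lebesgue_rV n : {sigma_finite_measure set 'rV[R]_n -> \bar R} :=
  match n with
  | 0 => [the {sigma_finite_measure set 'rV[R]_0 -> \bar R} of dirac (0 : 'rV[R]_0)]
  | k.+1 => [the {sigma_finite_measure set 'rV[R]_k.+1 -> \bar R} of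
              lebesgue_rV_step (lebesgue_rV k)]
  end.

Lemma lebesgue_rV_box n (A : 'I_n -> set (measurableTypeR R)) :
  (forall i, measurable (A i)) ->
  lebesgue_rV n [set x : 'rV[R]_n | forall i, A i (x ord0 i)] =
  (\prod_(i < n) lebesgue_measure (A i))%E.
Proof.
elim: n A => [|n IH] A mA.
  by rewrite big_ord0 /= diracE mem_set// => -[].
rewrite big_ord_recl -(IH (fun i => A (lift ord0 i)))// -product_measure1E//.
  rewrite /= /lebesgue_rV_step /pushforward; congr product_measure1.
  apply/seteqP; split => -[a v] /= H.
    split; first by have := H ord0; rewrite mxE unlift_none.
    by move=> i; have := H (lift ord0 i); rewrite mxE liftK.
  by move=> i; rewrite mxE; case: unliftP => [j|] ->; case: H => // _; apply.
rewrite [X in measurable X](_ : _ =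
    \bigcap_i ((fun x : 'rV[R]_n => x ord0 i : measurableTypeR R) @^-1`
      A (lift ord0 i))).
  apply: fin_bigcap_measurable => // i _.
  by rewrite -[X in measurable X]setTI; exact: measurable_rV_coord.
by apply/seteqP; split => x /= H i => [_|]; exact: H.
Qed.

End lebesgue_rV.

Section defs.
Context {R : realType}.
Implicit Types (N : nat) (s lambda m : R).

(* Euclidean norm; the library's norm on row vectors is the sup norm. *)
Definition enorm N (x : 'rV[R]_N) : R := Num.sqrt (\sum_(i < N) x ord0 i ^+ 2).

Definition eball N (x : 'rV[R]_N) (r : R) : set 'rV[R]_N :=
  [set y | enorm (y - x) < r].

Definition half_space N lambda : set 'rV[R]_N.+1 :=
  [set x | x ord0 ord0 < lambda].

Definition reflection N lambda (x : 'rV[R]_N.+1) : 'rV[R]_N.+1 :=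
  \row_i (if i == ord0 then 2 * lambda - x ord0 ord0 else x ord0 i).

Definition reflected N lambda (u : 'rV[R]_N.+1 -> R) : 'rV[R]_N.+1 -> R :=
  u \o reflection lambda.

Definition reflection_diff N lambda (u : 'rV[R]_N.+1 -> R) : 'rV[R]_N.+1 -> R :=
  fun x => reflected lambda u x - u x.

Definition Omega N lambda : set 'rV[R]_N.+1 :=
  half_space lambda `&` eball 0 1.

(* Non-emptiness is not required, so every real [lambda] is allowed. *)
Definition bounded_domain N (D : set 'rV[R]_N) :=
  [/\ bounded_set D, open D & connected D].

Definition is_min T (f : T -> R) (c : R) :=
  (exists z, f z = c) /\ forall z, c <= f z.

Definition is_max T (f : T -> R) (c : R) :=
  (exists z, f z = c) /\ forall z, f z <= c.

(* [pmin] and [pmax] are p^- and p^+, which the condition asserts to be attained. *)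
Definition condP1 N s m (p : 'rV[R]_N -> 'rV[R]_N -> R) :=
  let p2 := fun z : 'rV[R]_N * 'rV[R]_N => p z.1 z.2 in
  [/\ continuous p2, forall x y, 2 < p x y, 0 < m < 1 &
    exists pmin pmax, [/\ is_min p2 pmin, is_max p2 pmax,
      1 - 1 / ln m < pmin & s * pmax < N%:R]].

(* [R_+] is [0, +oo[: the value [Q 0 = p x x] is included.  Only the restriction
   of [Q] to it matters. *)
Definition condP2 N (p : 'rV[R]_N -> 'rV[R]_N -> R) :=
  exists Q : R -> R, [/\
    {within `[0, +oo[, continuous Q} /\ (forall t, 0 <= t -> 0 <= Q t),
    forall x y, p x y = Q (enorm (x - y)),
    {in `[0, +oo[ &, {homo Q : t r / t <= r}} &
    {in `[0, +oo[ &, {homo (fun t => t `^ Q t) : t r / t < r}}].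

(* [lim] is a total operator: it is the principal value when the limit exists. *)
Definition pv_integral N (f : 'rV[R]_N -> R) (x : 'rV[R]_N) : \bar R :=
  lim ((\int[lebesgue_rV N]_(y in ~` eball x e) (f y)%:E)%E @[e --> 0^'+]).

Definition frac_laplacian N s (p : 'rV[R]_N -> 'rV[R]_N -> R)
    (u : 'rV[R]_N -> R) (x : 'rV[R]_N) : \bar R :=
  pv_integral (fun y => `|u x - u y| `^ (p x y - 2) * (u x - u y)
                        / enorm (x - y) `^ (N%:R + s * p x y)) x.

(* Local integrability is integrability on compact sets. *)
Definition L1_loc N (u : 'rV[R]_N -> R) :=
  forall K, compact K -> (lebesgue_rV N).-integrable K (EFin \o u).

Definition Lsp N s (p : 'rV[R]_N -> 'rV[R]_N -> R) (u : 'rV[R]_N -> R) :=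
  L1_loc u /\ forall x,
    (\int[lebesgue_rV N]_y (`|u y| `^ (p x y - 1)
       / (1 + enorm y `^ (N%:R + s * p x y)))%:E < +oo)%E.

Definition grad N (u : 'rV[R]_N -> R) (x : 'rV[R]_N) : 'rV[R]_N :=
  \row_i 'D_(delta_mx ord0 i) u x.

Definition C11_loc N (u : 'rV[R]_N -> R) :=
  [/\ forall x, differentiable u x, continuous (grad u) &
      forall x : 'rV[R]_N, exists2 U : set 'rV[R]_N,
        nbhs x U & [lipschitz grad u y | y in U]].

(* Lower semicontinuity of the restriction of [u] to [A]. *)
Definition lsc_on N (A : set 'rV[R]_N) (u : 'rV[R]_N -> R) :=
  @lower_semicontinuous (subspace A) R (EFin \o u).

End defs.

(* Main.v *)
Require Import Defs.
From mathcomp Require Import all_boot all_order all_algebra.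
From mathcomp Require Import all_classical all_reals all_analysis.
From mathcomp Require Import measurable_realfun ring lra.

Import Order.TTheory GRing.Theory Num.Theory.
Import numFieldTopology.Exports numFieldNormedType.Exports.

Local Open Scope classical_set_scope.
Local Open Scope ring_scope.

(** Write w for u_lambda - u, H for the half-space x_1 < lambda, rho for the
    reflection, and let x be a point of H at which w is nonpositive and minimal
    over H.  Everything follows from one fact ([min_reflection_diff_ae]): if
    the difference of the two fractional Laplacians at x is nonnegative, then
    w(x) = 0 and w vanishes almost everywhere in H.

    The difference of the Laplacians is the principal value of
      D(y) = G_y(u_lambda(x) - u_lambda(y)) - G_y(u(x) - u(y)),
    with G_y(t) = |t|^(p-2) t / |x-y|^(N+sp) and p = p(x,y).  Folding the
    complement of H onto H by the reflection turns it into an integral over H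
    of S(y) = D(y) + D(rho y) ([fold_ae_eq0]), and the inequality S <= 0 is
    purely pointwise ([kernel_gap]).  With a = u_lambda(x), b = u(x),
    c = u_lambda(y), d = u(y), minimality gives a - c <= b - d.  For numbers in
    (-m, m) the increments of G decrease when y is replaced by rho y, which is
    further away from x: the denominator grows because t^Q(t) increases, and
    the increments of |t|^(q-2) t decrease in q ([signed_powR_exponent]), which
    is where the bound 1 - 1/ln m on the exponent enters.  Hence the first half
    of S may be replaced by the same increment with the weight of rho y; the
    four terms then regroup into increments from b - c to a - c and from b - d
    to a - d, which are nonpositive because a <= b.  So S <= 0, and S(y) = 0
    forces a = b and c = d.  Since the integral of S is nonnegative, S
    vanishes almost everywhere.

    This needs the principal values to exist as finite limits: a limit that
    does not exist has an arbitrary value, about which the hypothesis on the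
    Laplacians would say nothing.  Adding the values of the integrand at y and
    at 2x - y cancels its odd part; for a C^{1,1} function the sum is
    O(|y-x|^(2(1-s)-N)) near x ([pv_integrand_near], from the second
    differences bounded in [C11_loc_second_difference]), and it decays like
    |y-x|^(-N-2s) at infinity, so that it is integrable
    ([integrable_power_kernel]).  The principal value is half its integral
    ([pv_integral_cvg]).

    For the theorem, a negative value of w in H would be taken inside the unit
    ball, so w would have a negative minimum over H there, contradicting
    w(x) = 0.  If w vanishes at a point of H in the ball, that point is a
    minimum, so w = 0 almost everywhere in H, and then everywhere else because
    w is antisymmetric under the reflection. *)

(** * Signed powers *)

Section signed_power.
Context {R : realType}.
Implicit Types (q t a b M m : R).

Lemma powR_le1 q a : 0 <= a -> a <= 1 -> 0 <= q -> a `^ q <= 1.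
Proof.
move=> a0 a1 q0; have := ge0_ler_powR q0 _ _ a1.
by rewrite powR1; apply; rewrite nnegrE.
Qed.

Definition signed_powR q t : R := `|t| `^ (q - 2) * t.

Lemma signed_powRN q t : signed_powR q (- t) = - signed_powR q t.
Proof. by rewrite /signed_powR normrN mulrN. Qed.

Lemma signed_powR0 q : signed_powR q 0 = 0.
Proof. by rewrite /signed_powR mulr0. Qed.

Lemma ge0_signed_powR q t : 2 < q -> 0 <= t -> signed_powR q t = t `^ (q - 1).
Proof.
move=> q2 t0; rewrite /signed_powR ger0_norm// mulrC.
rewrite (_ : q - 2 = (q - 1) - 1); last by ring.
by rewrite mulr_powRB1//; lra.
Qed.

Lemma ltr_signed_powR q : 2 < q -> {homo signed_powR q : a b / a < b}.
Proof.
move=> q2.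
have pos a b : 0 <= a -> a < b -> signed_powR q a < signed_powR q b.
  move=> a0 ab; have b0 : 0 <= b by rewrite (le_trans a0)// ltW.
  by rewrite !ge0_signed_powR// gt0_ltr_powR ?nnegrE//; lra.
move=> a b ab; have [a0|a0] := leP 0 a; first exact: pos.
have [b0|b0] := leP b 0.
  by rewrite -ltrN2 -!signed_powRN pos//; lra.
apply: (@lt_trans _ _ 0); last by rewrite -(signed_powR0 q) pos.
by rewrite -oppr_gt0 -signed_powRN -(signed_powR0 q) pos//; lra.
Qed.

Lemma ler_signed_powR q : 2 < q -> {homo signed_powR q : a b / a <= b}.
Proof.
move=> q2 a b; rewrite le_eqVlt => /predU1P[->//|ab].
by rewrite ltW// ltr_signed_powR.
Qed.

Lemma continuous_powR q : 0 < q ->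
  forall a b, 0 <= a -> {within `[a, b], continuous (fun x : R => x `^ q)}.
Proof.
move=> q0 a b a0.
have [ab|ba] := ltP a b; last first.
  move: ba; rewrite le_eqVlt => /predU1P[->|ba].
    by rewrite set_itv1; exact: continuous_subspace1.
  by rewrite set_itv_ge ?bnd_simp -?ltNge//; exact: continuous_subspace0.
have cts x : 0 < x -> {for x, continuous (fun x : R => x `^ q)}.
  move=> x0; apply/differentiable_continuous/derivable1_diffP.
  by apply: derivable_powR; rewrite in_itv/= x0.
apply/continuous_within_itvP => //; split.
- by move=> x; rewrite in_itv/= => /andP[ax _]; apply: cts; exact: le_lt_trans ax.
- move: a0; rewrite le_eqVlt => /predU1P[<-|a0].
    by rewrite powR0 ?gt_eqF//; exact: powR_cvg0.
  exact/cvg_at_right_filter/cts.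
- by apply/cvg_at_left_filter/cts; exact: le_lt_trans ab.
Qed.

(** The mean value theorem on [a, b], where the derivative (q-1)t^(q-2) is at
    most its value at M. *)
Lemma signed_powR_sub_le q M a b : 2 < q -> 0 <= a -> a <= b -> b <= M ->
  signed_powR q b - signed_powR q a <= (q - 1) * M `^ (q - 2) * (b - a).
Proof.
move=> q2 a0 ab bM.
rewrite !ge0_signed_powR//; last exact: le_trans ab.
have [c cab ->] : exists2 c, c \in `[a, b] & b `^ (q - 1) - a `^ (q - 1) =
    ((q - 1) * c `^ (q - 1 - 1)) * (b - a).
  apply: (@MVT_segment _ (fun x => x `^ (q - 1))
    (fun c => (q - 1) * c `^ (q - 1 - 1))) => //.
    move=> x; rewrite in_itv/= => /andP[ax _]; apply: is_derive1_powR.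
    exact: le_lt_trans ax.
  by apply: continuous_powR => //; lra.
rewrite (_ : q - 1 - 1 = q - 2); last by ring.
move: cab; rewrite in_itv/= => /andP[ac cb].
rewrite ler_wpM2r ?subr_ge0// ler_wpM2l//; first lra.
by rewrite ge0_ler_powR ?nnegrE//; lra.
Qed.

(** The signed power is odd, so its sum at a and b is an increment from -b to a.
    This is what makes the contributions of two points symmetric about the
    singularity nearly cancel. *)
Lemma signed_powR_add_le q M a b : 2 < q -> `|a| <= M -> `|b| <= M ->
  `|signed_powR q a + signed_powR q b| <= (q - 1) * M `^ (q - 2) * `|a + b|.
Proof.
move=> q2.
wlog ab : a b / 0 <= a + b.
  move=> wl aM bM; have [ab|ab] := leP 0 (a + b); first exact: wl.
  rewrite -normrN opprD -!signed_powRN -(normrN (a + b)) (opprD a b).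
  by apply: wl; rewrite ?normrN//; lra.
wlog lab : a b ab / b <= a.
  move=> wl aM bM; have [ba|ba] := leP b a; first exact: wl.
  by rewrite addrC (addrC a); apply: wl => //; lra.
rewrite [`|a| <= M]ler_norml [`|b| <= M]ler_norml => /andP[aM1 aM2] /andP[bM1 bM2].
have a0 : 0 <= a by lra.
have s0 : 0 <= signed_powR q a + signed_powR q b.
  rewrite -[b]opprK signed_powRN subr_ge0.
  by apply: ler_signed_powR => //; lra.
rewrite !ger0_norm//.
have [b0|b0] := leP 0 b.
  have := signed_powR_sub_le _ M _ _ q2 (lexx 0) a0 aM2.
  have := signed_powR_sub_le _ M _ _ q2 (lexx 0) b0 bM2.
  rewrite signed_powR0 !subr0 => h1 h2.
  by rewrite mulrDr; lra.
by rewrite -[b]opprK signed_powRN; apply: signed_powR_sub_le => //; lra.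
Qed.

(** The function t^(q-1) - t^(q'-1) is nondecreasing on [0, m): its derivative
    has the sign of (q-1) - (q'-1)t^(q'-q), and
      (q'-q) ln t <= -(q'-q)/(q-1) <= ln ((q-1)/(q'-1)).
    The first inequality uses ln t <= ln m and the lower bound on q, the second
    is ln (1+x) <= x at x = (q'-q)/(q-1). *)
Lemma signed_powR_exponent_pos q q' m a b :
  2 < q -> q <= q' -> 0 < m < 1 -> 1 - 1 / ln m < q ->
  0 <= a -> a <= b -> b < m ->
  signed_powR q' b - signed_powR q' a <= signed_powR q b - signed_powR q a.
Proof.
move=> q2 qq' /andP[m0 m1] qm a0 ab bm.
rewrite !ge0_signed_powR//; try lra.
pose f := fun x : R => x `^ (q - 1) - x `^ (q' - 1).
suff : f a <= f b by rewrite /f; lra.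
have [||c] := @MVT_segment _ f
    (fun c => (q - 1) * c `^ (q - 1 - 1) - (q' - 1) * c `^ (q' - 1 - 1)) a b ab.
- move=> x; rewrite in_itv/= => /andP[ax _].
  have x0 : 0 < x by exact: le_lt_trans ax.
  by apply: is_deriveB; exact: is_derive1_powR.
- move=> x; apply: (@continuousB _ _ (subspace `[a, b])
    (fun x => x `^ (q - 1)) (fun x => x `^ (q' - 1)));
  by apply: continuous_powR => //; lra.
rewrite in_itv/= => /andP[ac cb] fab.
rewrite -subr_ge0 fab mulr_ge0 ?subr_ge0//.
have [->|c0] := eqVneq c 0.
  by rewrite !powR0; [rewrite !mulr0|rewrite gt_eqF//; lra..].
have {}c0 : 0 < c by rewrite lt_neqAle eq_sym c0 (le_trans a0).
rewrite (_ : q' - 1 - 1 = (q - 1 - 1) + (q' - q)); last by ring.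
rewrite powRD; last by rewrite (gt_eqF c0) implybT.
rewrite mulrCA [leRHS]mulrC ler_wpM2l ?powR_ge0//.
have lm : ln m < 0 by apply: ln_lt0; rewrite m0.
have lc : ln c <= ln m by rewrite ler_ln ?posrE//; lra.
rewrite -ler_pdivlMl; last by lra.
have rat : 0 < (q' - 1)^-1 * (q - 1) by rewrite mulr_gt0 ?invr_gt0//; lra.
rewrite -ler_ln ?posrE ?powR_gt0// ln_powR.
have h1 : (q' - q) * ln c <= - (q' - q) / (q - 1).
  rewrite ler_pdivlMr; last by lra.
  rewrite -mulrA -[leRHS]mulrN1 ler_wpM2l//; first by lra.
  have : - 1 / ln m < q - 1 by move: qm; rewrite !mulNr; lra.
  by rewrite ltr_ndivrMr// => h; nra.
apply: (le_trans h1).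
have -> : (q' - 1)^-1 * (q - 1) = (1 + (q' - q) / (q - 1))^-1.
  by field; rewrite subr_eq0 !gt_eqF; lra.
rewrite lnV ?posrE; last first.
  by rewrite ltr_pwDl// divr_ge0//; lra.
rewrite mulNr lerN2 le_ln1Dx//.
by apply: (@lt_le_trans _ _ 0); [lra|rewrite divr_ge0//; lra].
Qed.

(** Extension to (-m, m) by oddness: an interval containing 0 is cut there. *)
Lemma signed_powR_exponent q q' m a b :
  2 < q -> q <= q' -> 0 < m < 1 -> 1 - 1 / ln m < q ->
  - m < a -> a <= b -> b < m ->
  signed_powR q' b - signed_powR q' a <= signed_powR q b - signed_powR q a.
Proof.
move=> q2 qq' m01 qm ma ab bm.
have pos := signed_powR_exponent_pos _ _ _ _ _ q2 qq' m01 qm.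
have [a0|a0] := leP 0 a; first exact: pos.
have [b0|b0] := leP b 0.
  have := pos (- b) (- a); rewrite !signed_powRN.
  by move=> /(_ ltac:(lra) ltac:(lra) ltac:(lra)); lra.
have := pos 0 b; have := pos 0 (- a); rewrite !signed_powRN !signed_powR0.
move=> /(_ ltac:(lra) ltac:(lra) ltac:(lra)) h1.
move=> /(_ ltac:(lra) ltac:(lra) ltac:(lra)) h2.
lra.
Qed.

End signed_power.

(** * The Euclidean norm and measurability on row vectors *)

Section euclidean_norm.
Context {R : realType} {n : nat}.
Implicit Types x y : 'rV[R]_n.

Lemma enorm_ge0 x : 0 <= enorm x.
Proof. exact: sqrtr_ge0. Qed.

Lemma enormN x : enorm (- x) = enorm x.
Proof. by rewrite /enorm; under eq_bigr do rewrite mxE sqrrN. Qed.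

Lemma enorm_distC x y : enorm (x - y) = enorm (y - x).
Proof. by rewrite -enormN opprB. Qed.

Lemma enorm0 : enorm (0 : 'rV[R]_n) = 0.
Proof.
by rewrite /enorm big1 ?sqrtr0// => i _; rewrite mxE expr0n.
Qed.

Lemma coord_le_enorm x i : `|x ord0 i| <= enorm x.
Proof.
rewrite -sqrtr_sqr ler_sqrt; last by apply: sumr_ge0 => j _; exact: sqr_ge0.
by rewrite (bigD1 i)//= lerDl sumr_ge0// => j _; exact: sqr_ge0.
Qed.

Lemma enorm_eq0 x : enorm x = 0 -> x = 0.
Proof.
move=> x0; apply/rowP => i; rewrite mxE; apply/eqP.
by rewrite -normr_le0 -x0 coord_le_enorm.
Qed.

Lemma enorm_sub_gt0 x y : y != x -> 0 < enorm (y - x).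
Proof.
move=> yx; rewrite lt_neqAle enorm_ge0 andbT eq_sym.
by apply: contra yx => /eqP /enorm_eq0 /eqP; rewrite subr_eq0.
Qed.

(** Neighbourhoods of row vectors are given by the sup norm; this turns
    conditions that hold near a point into conditions on Euclidean balls. *)
Lemma norm_le_enorm x : `|x| <= enorm x.
Proof.
rewrite [leLHS]/Num.norm/= mx_normrE; apply: bigmax_le; first exact: enorm_ge0.
by move=> [i j] _ /=; rewrite (ord1 i) coord_le_enorm.
Qed.

Lemma continuous_enorm : continuous (@enorm R n).
Proof.
move=> x; apply: (@continuous_comp _ _ _ (fun x : 'rV[R]_n =>
  \sum_(i < n) x ord0 i ^+ 2) Num.sqrt); last exact: sqrt_continuous.
apply: (@continuous_big R 'I_n +%R 0 xpredT (@add_continuous R) 'rV[R]_n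
  (index_enum 'I_n) (fun i y => y ord0 i ^+ 2)) => i _ y.
apply: (@continuous_comp _ _ _ (fun y : 'rV[R]_n => y ord0 i) (fun t => t ^+ 2)).
  exact: coord_continuous.
exact: exprn_continuous.
Qed.

End euclidean_norm.

Section measurability.
Context {R : realType}.

(** An open set is the union of the countably many cubes with rational centre
    and radius 1/(k+1) that it contains, and a cube is a finite intersection
    of preimages of intervals by coordinates. *)
Lemma open_measurable_rV n (U : set 'rV[R]_n) : open U -> measurable U.
Proof.
move=> oU.
pose q2r (q : 'rV[rat]_n) : 'rV[R]_n := map_mx ratr q.
pose F (z : 'rV[rat]_n * nat) : set 'rV[R]_n :=
  if `[< ball (q2r z.1) z.2.+1%:R^-1 `<=` U >]
  then ball (q2r z.1) z.2.+1%:R^-1 else set0.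
have -> : U = \bigcup_z F z.
  apply/seteqP; split => [y Uy|y [[q k] _]]; last first.
    by rewrite /F; case: asboolP => // + yF; apply.
  have /nbhs_ballP[e /= e0 yeU] : nbhs y U by exact: open_nbhs_nbhs.
  have e20 : 0 < e / 2 by rewrite divr_gt0.
  have [k ke] := ltr_add_invr e20; rewrite add0r in ke.
  have k0 : 0 < (k.+1%:R)^-1 :> R by rewrite invr_gt0.
  have /choice[q qP] (i : 'I_n) : exists q : rat,
      `|ratr q - y ord0 i| < k.+1%:R^-1 :> R.
    have : y ord0 i - k.+1%:R^-1 < y ord0 i + k.+1%:R^-1.
      by rewrite ltrBlDr -addrA ltrDl addr_gt0.
    move=> /rat_in_itvoo[q]; rewrite in_itv/= => /andP[q1 q2].
    by exists q; rewrite ltr_distl q1.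
  have yq : ball (q2r (\row_i q i)) k.+1%:R^-1 y.
    by split => [|i j]; [exact: k0|rewrite (ord1 i) !mxE; exact: qP].
  exists (\row_i q i, k) => //; rewrite /F; case: asboolP => //=; case.
  move=> z qz; apply: yeU; apply: le_ball (ball_triangle (ball_sym yq) qz).
  by rewrite (splitr e) lerD// ltW.
apply: countable_bigcupT_measurable; first exact: countableP.
move=> [q k]; rewrite /F; case: ifPn => // _.
rewrite [X in measurable X](_ : _ =
    \bigcap_i ((fun x : 'rV[R]_n => x ord0 i : measurableTypeR R) @^-1`
      (ball (ratr (q ord0 i) : R) k.+1%:R^-1))).
  apply: fin_bigcap_measurable => // i _.
  rewrite -[X in measurable X]setTI; apply: measurable_rV_coord => //.
  exact: measurable_ball.
apply/seteqP; split => x /=.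
  by move=> [_ qx] i _; have := qx ord0 i; rewrite mxE.
move=> qx; split; first by rewrite invr_gt0.
by move=> i j; rewrite (ord1 i) mxE; exact: qx.
Qed.

Lemma continuous_measurable_rV n (f : 'rV[R]_n -> R) :
  continuous f -> measurable_fun setT f.
Proof.
move=> /continuousP cf; apply: (measurability _ (RGenOpens.measurableE R)).
move=> _ [_ [a [b ->] <-]]; rewrite setTI.
apply: open_measurable_rV; apply: cf; exact: interval_open.
Qed.

Lemma measurable_fun_powR d (T : measurableType d) (f g : T -> R) :
  measurable_fun setT f -> measurable_fun setT g ->
  measurable_fun setT (fun x => f x `^ g x).
Proof.
move=> mf mg; rewrite /powR; apply: measurable_fun_ifT.
- exact: measurable_fun_eqr.
- apply: (@measurableT_comp _ _ _ _ _ _ (fun b : bool => (b : nat)%:R : R) _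
    (fun x => g x == 0)) => //.
  exact: measurable_fun_eqr.
- apply: (@measurableT_comp _ _ _ _ _ _ expR) => //.
  apply: measurable_funM => //.
  exact: measurableT_comp (@measurable_ln R) mf.
Qed.

End measurability.

(** * Measure-preserving maps *)

Section measure_preserving.
Context {R : realType} {d} {T : measurableType d}.
Variable mu : {measure set T -> \bar R}.

Definition measure_preserving (tau : T -> T) :=
  measurable_fun setT tau /\
  forall A, measurable A -> mu (tau @^-1` A) = mu A.

Variable tau : T -> T.
Hypothesis tauP : measure_preserving tau.

Lemma measure_preserving_preimage A : measurable A -> measurable (tau @^-1` A).
Proof. by move=> mA; rewrite -[X in measurable X]setTI; exact: tauP.1. Qed.

Lemma ge0_integral_measure_preserving D (f : T -> \bar R) :
  measurable D -> measurable_fun setT f -> (forall x, 0 <= f x)%E ->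
  (\int[mu]_(x in tau @^-1` D) f (tau x) = \int[mu]_(x in D) f x)%E.
Proof.
move=> mD mf f0.
transitivity (\int[pushforward mu tau]_(x in D) f x)%E.
  symmetry; apply: ge0_integral_pushforward => //; first exact: tauP.1.
  exact: measurable_funTS.
apply: eq_measure_integral => [|? A mA _]; [exact: tauP.1|exact: tauP.2].
Qed.

Lemma integrable_measure_preserving D (f : T -> R) :
  measurable D -> measurable_fun setT f -> mu.-integrable D (EFin \o f) ->
  mu.-integrable (tau @^-1` D) (EFin \o (f \o tau)).
Proof.
move=> mD mf /integrableP[_ fD]; apply/integrableP; split.
  apply: measurable_funTS; apply/measurable_EFinP.
  exact: measurableT_comp tauP.1.
rewrite (ge0_integral_measure_preserving D (fun x => `|(f x)%:E|%E))//.
by do 2 apply: measurableT_comp => //.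
Qed.

Lemma integral_measure_preserving D (f : T -> R) :
  measurable D -> measurable_fun setT f -> mu.-integrable D (EFin \o f) ->
  (\int[mu]_(x in tau @^-1` D) (f (tau x))%:E = \int[mu]_(x in D) (f x)%:E)%E.
Proof.
move=> mD mf fD.
rewrite -(@integral_pushforward _ _ _ _ _ _ tauP.1 mu D (EFin \o f))//; last 2 first.
- exact/measurable_EFinP.
- exact: integrable_measure_preserving.
apply: eq_measure_integral => [|? A mA _]; [exact: tauP.1|exact: tauP.2].
Qed.

Lemma integral_symmetrize D (f : T -> R) :
  measurable D -> tau @^-1` D = D -> measurable_fun setT f ->
  mu.-integrable D (EFin \o f) ->
  (\int[mu]_(x in D) (f x)%:E =
   (2^-1)%:E * \int[mu]_(x in D) (f x + f (tau x))%:E)%E.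
Proof.
move=> mD tauD mf iD.
have iDtau := integrable_measure_preserving _ _ mD mf iD.
have E := integral_measure_preserving _ _ mD mf iD.
rewrite tauD in iDtau E.
have -> : (\int[mu]_(x in D) (f x + f (tau x))%:E =
    \int[mu]_(x in D) (f x)%:E + \int[mu]_(x in D) (f (tau x))%:E)%E.
  exact: (integralD mD iD iDtau).
rewrite E; move: (integrable_fin_num mD iD); rewrite /comp.
case: (\int[mu]_(x in D) (f x)%:E)%E => // r _.
by rewrite -EFinD -EFinM; congr EFin; field.
Qed.

End measure_preserving.

Section lebesgue_preserving.
Context {R : realType}.

Lemma lebesgue_measure_shift (c : R) :
  measure_preserving (@lebesgue_measure R) (fun t : measurableTypeR R => c + t).
Proof.
pose f (t : measurableTypeR R) : measurableTypeR R := c + t.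
have mf : measurable_fun setT f.
  exact: measurable_funD.
split => // A mA.
pose m : {measure set (measurableTypeR R) -> \bar R} :=
  measure_function_pushforward__canonical__measure_function_Measure
   (@lebesgue_measure R) mf.
rewrite -[LHS]/(m A); symmetry; apply: lebesgue_measure_unique => // _ [[a b] _ <-] /=.
rewrite /m/= /pushforward (_ : _ @^-1` _ = `]a - c, b - c]%classic); last first.
  by apply/seteqP; split => x /=; rewrite !in_itv/= ltrBlDl lerBrDl.
rewrite !lebesgue_measure_itv/= !lte_fin ltrD2r.
by case: ifP => // _; rewrite -!EFinB; congr EFin; ring.
Qed.

Lemma lebesgue_measure_reflect (c : R) :
  measure_preserving (@lebesgue_measure R) (fun t : measurableTypeR R => c - t).
Proof.
pose f (t : measurableTypeR R) : measurableTypeR R := c - t.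
have mf : measurable_fun setT f.
  exact: measurable_funB.
split => // A mA.
pose m : {measure set (measurableTypeR R) -> \bar R} :=
  measure_function_pushforward__canonical__measure_function_Measure
   (@lebesgue_measure R) mf.
rewrite -[LHS]/(m A); symmetry; apply: lebesgue_measure_unique => // _ [[a b] _ <-] /=.
rewrite /m/= /pushforward (_ : _ @^-1` _ = `[c - b, c - a[%classic); last first.
  apply/seteqP; split => x /=; rewrite !in_itv/= => /andP[h1 h2].
    by rewrite lerBlDr -lerBlDl h2 ltrBrDl -ltrBrDr.
  by rewrite lerBlDl -lerBlDr h1 andbT ltrBrDr -ltrBrDl.
rewrite !lebesgue_measure_itv/= !lte_fin ltrD2l ltrN2.
by case: ifP => // _; rewrite -!EFinB; congr EFin; ring.
Qed.

(** By induction on the dimension, using uniqueness of the product measure. *)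
Lemma lebesgue_rV_coordwise n (phi : 'I_n -> R -> R) :
  (forall i, measure_preserving (@lebesgue_measure R)
     (phi i : measurableTypeR R -> measurableTypeR R)) ->
  measure_preserving (lebesgue_rV n)
    (fun x : 'rV[R]_n => \row_i phi i (x ord0 i)).
Proof.
elim: n phi => [|n IH] phi phiP.
  split; first by apply: measurable_fun_rVP => -[].
  move=> A mA; congr (_ _).
  by apply/seteqP; split => x /=; rewrite [\row_i _]thinmx0 [x]thinmx0.
have mtau : measurable_fun setT (fun x : 'rV[R]_n.+1 => \row_i phi i (x ord0 i)).
  apply: measurable_fun_rVP => i; under eq_fun do rewrite mxE.
  by apply: measurableT_comp (measurable_rV_coord i); have [] := phiP i.
split => // A mA.
have [mtau' tau'E] := IH (fun i => phi (lift ord0 i)) (fun i => phiP _).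
have [mphi0 phi0E] := phiP ord0.
set tau' := (fun x : 'rV[R]_n => _) in mtau' tau'E.
pose g (z : measurableTypeR R * 'rV[R]_n) : measurableTypeR R * 'rV[R]_n :=
  (phi ord0 z.1, tau' z.2).
have mg : measurable_fun setT g.
  apply/measurable_fun_pairP; split.
    exact: measurableT_comp mphi0 measurable_fst.
  exact: measurableT_comp mtau' measurable_snd.
pose M := (@lebesgue_measure R \x lebesgue_rV n)%E.
pose m : {measure set _ -> \bar R} :=
  measure_function_pushforward__canonical__measure_function_Measure M mg.
have mE X : measurable X -> M X = m X.
  apply: product_measure_unique => B C mB mC.
  rewrite /m/= /pushforward
    (_ : _ @^-1` _ = (phi ord0 @^-1` B) `*` (tau' @^-1` C)); last first.
    by apply/seteqP; split => -[].
  rewrite /M product_measure1E ?phi0E ?tau'E//.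
    by rewrite -[X in measurable X]setTI; exact: mphi0.
  by rewrite -[X in measurable X]setTI; exact: mtau'.
rewrite /= /lebesgue_rV_step {2}/pushforward -/M mE; last first.
  by rewrite -[X in measurable X]setTI; exact: measurable_rV_cons.
rewrite /m/= /pushforward; congr (_ _).
suff E z : rV_cons (g z) = \row_i phi i (rV_cons z ord0 i).
  by apply/seteqP; split => z /=; rewrite E.
by apply/rowP => i; rewrite !mxE; case: unliftP => [j|] -> //=; rewrite !mxE.
Qed.

Lemma lebesgue_rV_shift n (c : 'rV[R]_n) :
  measure_preserving (lebesgue_rV n) (fun x => x + c).
Proof.
rewrite (_ : (fun x => x + c) = (fun x => \row_i (c ord0 i + x ord0 i))).
  apply: (lebesgue_rV_coordwise _ (fun i t => c ord0 i + t)) => i.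
  exact: lebesgue_measure_shift.
by apply/funext => x; apply/rowP => i; rewrite !mxE addrC.
Qed.

(** For c = 2x this is the symmetry about x, used to symmetrize principal
    values. *)
Lemma lebesgue_rV_point_reflection n (c : 'rV[R]_n) :
  measure_preserving (lebesgue_rV n) (fun x => c - x).
Proof.
rewrite (_ : (fun x => c - x) = (fun x => \row_i (c ord0 i - x ord0 i))).
  apply: (lebesgue_rV_coordwise _ (fun i t => c ord0 i - t)) => i.
  exact: lebesgue_measure_reflect.
by apply/funext => x; apply/rowP => i; rewrite !mxE.
Qed.

Lemma lebesgue_rV_reflection N (lambda : R) :
  measure_preserving (lebesgue_rV N.+1) (@reflection R N lambda).
Proof.
rewrite (_ : reflection lambda = (fun x => \row_i
    (if i == ord0 then 2 * lambda - x ord0 i else 0 + x ord0 i))); last first.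
  apply/funext => x; apply/rowP => i; rewrite !mxE add0r.
  by case: eqP => [->|].
apply: (lebesgue_rV_coordwise _
  (fun i t => if i == ord0 then 2 * lambda - t else 0 + t)) => i.
case: (i == ord0); first exact: lebesgue_measure_reflect.
exact: lebesgue_measure_shift.
Qed.

End lebesgue_preserving.

(** * Integrability of power kernels *)

Section kernel.
Context {R : realType}.

Lemma measurable_enorm n : measurable_fun setT (@enorm R n).
Proof. by apply: continuous_measurable_rV; exact: continuous_enorm. Qed.

Lemma measurable_eball n (x : 'rV[R]_n) r : measurable (eball x r).
Proof.
apply: open_measurable_rV.
rewrite (_ : eball x r = (fun y => enorm (y - x)) @^-1` `]-oo, r[).
  apply: open_comp; last exact: interval_open.
  move=> y _; apply: (@continuous_comp _ _ _ (fun y : 'rV[R]_n => y - x) (@enorm R n)).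
    move=> /=; apply: (@continuousB _ _ _ id (fun=> x)); first exact: cvg_id.
    exact: cst_continuous.
  exact: continuous_enorm.
by apply/seteqP; split => y /=; rewrite in_itv.
Qed.

Lemma measurable_rV_box n (A : 'I_n -> set (measurableTypeR R)) :
  (forall i, measurable (A i)) ->
  measurable [set x : 'rV[R]_n | forall i, A i (x ord0 i)].
Proof.
move=> mA; rewrite (_ : mkset _ =
    \bigcap_i ((fun x : 'rV[R]_n => x ord0 i : measurableTypeR R) @^-1` A i)).
  apply: fin_bigcap_measurable => // i _.
  by rewrite -[X in measurable X]setTI; apply: measurable_rV_coord.
by apply/seteqP; split => x /= H i => [_|]; exact: H.
Qed.

(** The ball lies in a cube of side 2r; only the power of r matters below. *)
Lemma lebesgue_rV_eball_le n (r : R) : 0 < r ->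
  (lebesgue_rV n (eball 0 r) <= ((2 * r) ^+ n)%:E)%E.
Proof.
move=> r0; pose I : set (measurableTypeR R) := `]-r, r[%classic.
have mI : measurable I by exact: measurable_itv.
have -> : ((2 * r) ^+ n)%:E = lebesgue_rV n [set x : 'rV[R]_n | forall i, I (x ord0 i)].
  rewrite (lebesgue_rV_box (fun=> mI)) (eq_bigr (fun=> (2 * r)%:E)); last first.
    move=> i _; rewrite /I lebesgue_measure_itv/= lte_fin gtrN// -EFinB.
    by congr EFin; ring.
  elim: n => [|n IH]; first by rewrite big_ord0.
  by rewrite big_ord_recl -IH exprS.
apply: le_measure; rewrite ?inE.
- exact: measurable_eball.
- exact: (measurable_rV_box _ (fun=> I) (fun=> mI)).
- move=> x; rewrite /eball/= subr0 => xr i.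
  by rewrite /I/= in_itv/= -ltr_norml (le_lt_trans (coord_le_enorm x i)).
Qed.

(** The last hypothesis bounds h by the sum of the functions
    c_k 1_{B(0, r_k)}, whose integrals are dominated by a geometric series. *)
Lemma dyadic_integral_lty n (h : 'rV[R]_n -> R) (c r : nat -> R) (a theta : R) :
  0 <= a -> 0 < theta < 1 -> measurable_fun setT h -> (forall z, 0 <= h z) ->
  (forall k, 0 <= c k) -> (forall k, 0 < r k) ->
  (forall k, c k * (2 * r k) ^+ n <= a * theta ^+ k) ->
  (forall z, h z = 0 \/ exists2 k, enorm z < r k & h z <= c k) ->
  (\int[lebesgue_rV n]_z (h z)%:E < +oo)%E.
Proof.
move=> a0 /andP[t0 t1] mh h0 c0 r0 crt hP.
pose F k (z : 'rV[R]_n) : \bar R := ((c k)%:E * (\1_(eball 0 (r k)) z)%:E)%E.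
have F0 k z : (0 <= F k z)%E by rewrite mule_ge0 ?lee_fin.
have mF k : measurable_fun setT (F k).
  apply: emeasurable_funM => //; apply/measurable_EFinP.
  by apply: measurable_indic; exact: measurable_eball.
apply: (@le_lt_trans _ _ (\int[lebesgue_rV n]_z (\sum_(0 <= k <oo) F k z))%E).
  apply: ge0_le_integral => //=.
  - by move=> z _; rewrite lee_fin.
  - exact/measurable_EFinP.
  - by apply: ge0_emeasurable_sum => // k z _.
  move=> z _; have [->|[k zr hc]] := hP z; first exact: nneseries_ge0.
  apply: (@le_trans _ _ (F k z)).
    by rewrite /F indicE mem_set ?mule1 ?lee_fin// /eball/= subr0.
  apply: (le_trans _ (nneseries_lim_ge k.+1 _)) => //.
  by rewrite big_nat_recr//= leeDr// sume_ge0.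
rewrite integral_nneseries//.
have Fk k : (\int[lebesgue_rV n]_z F k z <= (a * theta ^+ k)%:E)%E.
  rewrite ge0_integralZl//; last 2 first.
  - by apply/measurable_EFinP; apply: measurable_indic; exact: measurable_eball.
  - by rewrite lee_fin.
  rewrite integral_indic//; last exact: measurable_eball.
  rewrite setIT; apply: (@le_trans _ _ ((c k)%:E * ((2 * r k) ^+ n)%:E)%E).
    by rewrite lee_wpmul2l ?lee_fin// lebesgue_rV_eball_le.
  by rewrite -EFinM lee_fin.
apply: (@le_lt_trans _ _ (a / (1 - theta))%:E); last by rewrite ltry.
apply: lime_le.
  by apply: is_cvg_nneseries => k _ _; exact: integral_ge0.
apply: nearW => k; apply: (@le_trans _ _ (\sum_(0 <= i < k) (a * theta ^+ i)%:E)%E).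
  exact: lee_sum.
rewrite sumEFin lee_fin; apply: geometric_le_lim => //.
by rewrite ger0_norm// ltW.
Qed.

Lemma dyadic_lower (t : R) : 1 <= t -> exists k, 2 ^+ k <= t < 2 ^+ k.+1.
Proof.
move=> t1; pose P k := t < 2 ^+ k.+1.
have eP : exists k, P k.
  by exists (Num.bound t); apply: upper_nthrootP.
exists (ex_minn eP); case: ex_minnP => k Pk kmin; apply/andP; split => //.
case: k Pk kmin => [|k] _ kmin; first by rewrite expr0.
by rewrite leNgt; apply/negP => /kmin; rewrite ltnn.
Qed.

End kernel.

Section power_kernel.
Context {R : realType} {n : nat}.
Variable gamma : R.
Hypothesis gamma_gt0 : 0 < gamma.
Let theta : R := 2 `^ (- gamma).

Let theta01 : 0 < theta < 1.
Proof.
rewrite powR_gt0//= /theta powRN invf_lt1 ?powR_gt0//.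
by rewrite -[ltLHS](powRr0 2) /powR pnatr_eq0/= ltr_expR ltr_pM2r// ln_gt0 ?ltr1n.
Qed.

Let two_gt0 k : (0 : R) < 2 ^+ k.
Proof. by rewrite exprn_gt0. Qed.

Let thetaX k : theta ^+ k = ((2 ^+ k) `^ gamma)^-1.
Proof.
transitivity (theta `^ k%:R); first by rewrite powR_mulrn// powR_ge0.
have -> : 2 ^+ k = 2 `^ k%:R :> R by rewrite powR_mulrn.
by rewrite /theta -powRrM -powRN -powRrM mulNr mulrN mulrC.
Qed.

Let measurable_power (e : R) : measurable_fun setT (fun z : 'rV[R]_n => enorm z `^ e).
Proof. by apply: measurable_fun_powR => //; exact: measurable_enorm. Qed.

Let measurable_enorm_lt1 : measurable_fun setT (fun z : 'rV[R]_n => enorm z < 1).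
Proof. by apply: measurable_fun_ltr => //; exact: measurable_enorm. Qed.

(** On 2^-(k+1) <= |z| <= 2^-k the integrand is at most
    (2^-k)^gamma (2^(k+1))^n, and the measure of the ball of radius 2^(1-k) is
    at most (4/2^k)^n. *)
Lemma power_kernel_near_lty :
  (\int[lebesgue_rV n]_z (if enorm z < 1 then enorm z `^ (gamma - n%:R) else 0)%:E
    < +oo)%E.
Proof.
apply: (@dyadic_integral_lty _ _ _ (fun k => theta ^+ k * (2 * 2 ^+ k) ^+ n)
  (fun k => 2 / 2 ^+ k) (8 ^+ n) theta) => //.
- exact: measurable_fun_ifT.
- by move=> z; case: ifP => // _; exact: powR_ge0.
- move=> k; rewrite mulr_ge0// exprn_ge0//; first exact: powR_ge0.
- move=> k; rewrite -mulrA -exprMn mulrC le_eqVlt; apply/orP; left; apply/eqP.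
  by congr (_ ^+ _ * _); field; rewrite gt_eqF.
move=> z; case: ifPn => [z1|_]; [right|by left].
have [z0|z0] := eqVneq (enorm z) 0.
  (* At the origin the kernel is 1 if gamma = n, and 0 otherwise. *)
  exists 0%N; first by rewrite expr0 divr1 z0.
  rewrite z0 expr0 mul1r expr0 mulr1 (@le_trans _ _ 1)//.
    by rewrite /powR eqxx; case: (_ == _).
  by rewrite exprn_ege1// ler1n.
have {}z0 : 0 < enorm z by rewrite lt_neqAle eq_sym z0 enorm_ge0.
have [k /andP[k1 k2]] : exists k, 2 ^+ k <= (enorm z)^-1 < 2 ^+ k.+1.
  by apply: dyadic_lower; rewrite invf_ge1// ltW.
have zk : enorm z <= (2 ^+ k)^-1 by rewrite -[leLHS]invrK lef_pV2 ?posrE ?invr_gt0.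
exists k.
  by rewrite (le_lt_trans zk)// -[ltLHS]mul1r ltr_pM2r ?invr_gt0// ltr1n.
rewrite powRD; last by rewrite (gt_eqF z0) implybT.
apply: ler_pM; rewrite ?powR_ge0//.
  rewrite thetaX -[X in _ <= X]powR_inv1 ?powR_ge0// powRAC powR_inv1; last exact: ltW.
  by rewrite ge0_ler_powR ?nnegrE ?invr_ge0 ?enorm_ge0// ltW.
rewrite powR_invn ?enorm_ge0// -exprVn lerXn2r ?nnegrE ?invr_ge0 ?enorm_ge0//.
by rewrite -exprS ltW.
Qed.

(** On 2^k <= |z| < 2^(k+1) the integrand is at most (2^k)^(-gamma-n), and the
    measure of the ball of radius 2^(k+1) is at most (4 2^k)^n. *)
Lemma power_kernel_far_lty :
  (\int[lebesgue_rV n]_z (if enorm z < 1 then 0 else enorm z `^ (- gamma - n%:R))%:E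
    < +oo)%E.
Proof.
apply: (@dyadic_integral_lty _ _ _ (fun k => theta ^+ k * ((2 ^+ k)^-1) ^+ n)
  (fun k => 2 ^+ k.+1) (4 ^+ n) theta) => //.
- exact: measurable_fun_ifT.
- by move=> z; case: ifP => // _; exact: powR_ge0.
- by move=> k; rewrite mulr_ge0// exprn_ge0// ?powR_ge0// invr_ge0 ltW.
- move=> k; rewrite -mulrA -exprMn mulrC le_eqVlt; apply/orP; left; apply/eqP.
  by congr (_ ^+ _ * _); rewrite exprS; field; rewrite gt_eqF.
move=> z; case: ifPn => [_|]; [by left|rewrite -leNgt => z1; right].
have [k /andP[k1 k2]] := dyadic_lower _ z1.
have z0 : 0 < enorm z by exact: lt_le_trans z1.
exists k => //.
rewrite powRD; last by rewrite (gt_eqF z0) implybT.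
apply: ler_pM; rewrite ?powR_ge0//.
  rewrite thetaX powRN lef_pV2 ?posrE ?powR_gt0//.
  by rewrite ge0_ler_powR ?nnegrE// ltW.
rewrite powR_invn ?enorm_ge0// -[leLHS]exprVn lerXn2r ?nnegrE ?invr_ge0 ?enorm_ge0//.
by rewrite lef_pV2 ?posrE.
Qed.

(** The kernel |z|^-n min(|z|, 1/|z|)^gamma; one exponent gamma on both sides
    of the unit sphere allows a single dominating function for the
    symmetrized integrand of a principal value. *)
Definition power_kernel (z : 'rV[R]_n) : R :=
  enorm z `^ ((if enorm z < 1 then gamma else - gamma) - n%:R).

Lemma power_kernel_ge0 z : 0 <= power_kernel z.
Proof. exact: powR_ge0. Qed.

Lemma integrable_power_kernel :
  (lebesgue_rV n).-integrable setT (EFin \o power_kernel).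
Proof.
have mnear : measurable_fun setT
    (fun z : 'rV[R]_n => if enorm z < 1 then enorm z `^ (gamma - n%:R) else 0).
  exact: measurable_fun_ifT.
have mfar : measurable_fun setT
    (fun z : 'rV[R]_n => if enorm z < 1 then 0 else enorm z `^ (- gamma - n%:R)).
  exact: measurable_fun_ifT.
have -> : EFin \o power_kernel = (fun z : 'rV[R]_n =>
    (if enorm z < 1 then enorm z `^ (gamma - n%:R) else 0)%:E +
    (if enorm z < 1 then 0 else enorm z `^ (- gamma - n%:R))%:E)%E.
  apply/funext => z; rewrite /= /power_kernel -EFinD.
  by case: ifP => _; rewrite ?addr0 ?add0r.
apply: integrableD => //; apply/integrableP; split; try exact/measurable_EFinP.
  under eq_integral.
    move=> z _; rewrite gee0_abs; last first.
      by rewrite lee_fin; case: ifP => // _; exact: powR_ge0.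
  over.
  exact: power_kernel_near_lty.
under eq_integral.
  move=> z _; rewrite gee0_abs; last by rewrite lee_fin; case: ifP => // _; exact: powR_ge0.
over.
exact: power_kernel_far_lty.
Qed.

End power_kernel.

(** * Second differences of functions of class C^{1,1} *)

Section C11.
Context {R : realType} {n : nat}.
Implicit Types (u : 'rV[R]_n -> R) (x y z : 'rV[R]_n).

Lemma deriveE_grad u x z : differentiable u x ->
  'D_z u x = \sum_(i < n) z ord0 i * grad u x ord0 i.
Proof.
move=> du; rewrite deriveE// {1}[z]row_sum_delta linear_sum.
by apply: eq_bigr => i _; rewrite linearZ/= mxE deriveE.
Qed.

Lemma is_derive_line u x z (t : R) : differentiable u (x + t *: z) ->
  is_derive t 1 (fun t => u (x + t *: z)) ('D_z u (x + t *: z)).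
Proof.
move=> du; have dz : derivable u (x + t *: z) z by exact: diff_derivable.
have E : (fun h : R => h^-1 *: (((fun t => u (x + t *: z)) \o shift t) (h *: 1) -
      u (x + t *: z))) =
    (fun h : R => h^-1 *: ((u \o shift (x + t *: z)) (h *: z) - u (x + t *: z))).
  apply/funext => h; congr (_ *: (u _ - _)) => /=.
  by rewrite /GRing.scale/= mulr1 -/(GRing.scale _ _) scalerDl addrCA addrA.
split; first by rewrite /derivable E.
by rewrite /derive E.
Qed.

Lemma norm_dot_le z (v : 'rV[R]_n) (c : R) : (forall i, `|v ord0 i| <= c) ->
  `|\sum_(i < n) z ord0 i * v ord0 i| <= n%:R * (enorm z * c).
Proof.
move=> vc; apply: (le_trans (ler_norm_sum _ _ _)).
apply: (@le_trans _ _ (\sum_(i < n) enorm z * c)); last first.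
  by rewrite sumr_const card_ord mulr_natl.
by apply: ler_sum => i _; rewrite normrM ler_pM// coord_le_enorm.
Qed.

Lemma coord_le_norm (v : 'rV[R]_n) i : `|v ord0 i| <= `|v|.
Proof.
rewrite [leRHS]/Num.norm/= mx_normrE.
exact: (le_bigmax _ (fun ij : 'I_1 * 'I_n => `|v ij.1 ij.2|) (ord0, i)).
Qed.

(** The mean value theorem along the segments from x to x + z and x - z.  The
    derivative of t |-> u(x + tz) + u(x - tz) is the scalar product of z with a
    difference of gradients at points 2tz apart, hence O(|z|^2). *)
Lemma C11_loc_second_difference u x : C11_loc u ->
  exists d L C, [/\ 0 < d <= 1, 1 <= L, 0 <= C & forall z, enorm z < d ->
    `|u (x + z) - u x| <= L * enorm z /\
    `|(u (x + z) - u x) + (u (x - z) - u x)| <= C * enorm z ^+ 2].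
Proof.
move=> [du cg /(_ x)[U /nbhs_ballP[d0 /= d00 dU] [M [_ /(_ (Num.max 1 (M + 1)))]]]].
set k := Num.max 1 (M + 1) => /(_ ltac:(by rewrite lt_max ltrDl ltr01 orbT)) kU.
have k0 : 0 <= k by rewrite le_max ler01.
pose d := Num.min 1 d0.
have dd0 : d <= d0 by rewrite ge_min lexx orbT.
have d1 : d <= 1 by rewrite ge_min lexx.
have inU z (t : R) : enorm z < d -> `|t| <= 1 -> U (x + t *: z).
  move=> zd t1; apply: dU; rewrite mx_norm_ball /ball_/= opprD addNKr normrN normrZ.
  rewrite (le_lt_trans _ (lt_le_trans zd dd0))//.
  by rewrite (le_trans _ (norm_le_enorm z))// ler_piMl.
have lip y1 y2 i : U y1 -> U y2 ->
    `|grad u y1 ord0 i - grad u y2 ord0 i| <= k * `|y1 - y2|.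
  move=> Uy1 Uy2; have := kU (y1, y2) (conj Uy1 Uy2); apply: le_trans.
  by have := coord_le_norm (grad u y1 - grad u y2) i; rewrite !mxE.
exists d, (n%:R * (`|grad u x| + k) + 1), (n%:R * (k * 2)); split.
- by rewrite lt_min ltr01 d00.
- by rewrite lerDr mulr_ge0// addr_ge0.
- by rewrite !mulr_ge0.
move=> z zd; have Ux : U x by have := inU z 0 zd; rewrite scale0r addr0 normr0; apply.
have line y (t : R) := is_derive_line u x y t (du _).
split.
  have [|c] := @MVT_segment _ (fun t => u (x + t *: z))
    (fun t => 'D_z u (x + t *: z)) 0 1 ler01.
  - by apply: derivable_within_continuous => t _; apply: ex_derive; exact: line.
  rewrite in_itv/= => /andP[c0 c1].
  rewrite scale1r scale0r addr0 subr0 mulr1 => ->.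
  rewrite deriveE_grad// (le_trans (norm_dot_le _ _ (`|grad u x| + k) _))//; last first.
    rewrite mulrCA mulrC ler_wpM2r ?enorm_ge0// lerDl//.
  move=> i; have Uc : U (x + c *: z) by apply: inU => //; rewrite ger0_norm.
  have := lip _ _ i Uc Ux; rewrite addrAC subrr add0r => h.
  rewrite -(subrK (grad u x ord0 i) (grad u _ _ _)) addrC.
  rewrite (le_trans (ler_normD _ _))// lerD ?coord_le_norm// (le_trans h)//.
  rewrite ler_piMr// normrZ mulr_ile1 ?ger0_norm//.
  by rewrite (le_trans (norm_le_enorm z))// ltW// (lt_le_trans zd).
have der (t : R) : is_derive t 1 (fun t => u (x + t *: z) + u (x + t *: - z))
    ('D_z u (x + t *: z) + 'D_(- z) u (x + t *: - z)).
  by apply: is_deriveD; exact: line.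
have [|c] := @MVT_segment _ (fun t => u (x + t *: z) + u (x + t *: - z)) (fun t =>
    'D_z u (x + t *: z) + 'D_(- z) u (x + t *: - z)) 0 1 ler01.
  by apply: derivable_within_continuous => t _; apply: ex_derive; exact: der.
rewrite in_itv/= => /andP[c0 c1].
rewrite !scale1r !scale0r !addr0 subr0 mulr1 => E.
have -> : u (x + z) - u x + (u (x - z) - u x) = u (x + z) + u (x - z) - (u x + u x) by ring.
rewrite E !deriveE_grad// -big_split/=.
rewrite (eq_bigr (fun i => z ord0 i *
    (grad u (x + c *: z) - grad u (x + c *: - z)) ord0 i)); last first.
  by move=> i _; rewrite !mxE; ring.
rewrite (le_trans (norm_dot_le _ _ (k * (2 * enorm z)) _))//; last first.
  by rewrite le_eqVlt; apply/orP; left; apply/eqP; ring.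
move=> i.
have Up : U (x + c *: z) by apply: inU => //; rewrite ger0_norm.
have Um : U (x + c *: - z) by apply: inU; rewrite ?enormN// ger0_norm.
rewrite [_ ord0 i]mxE [(- grad _ _) _ _]mxE (le_trans (lip _ _ i Up Um))// ler_wpM2l//.
rewrite scalerN opprD opprK addrACA subrr add0r -mulr2n -scaler_nat normrZ.
rewrite ger0_norm// ler_wpM2l// normrZ ger0_norm// (le_trans _ (norm_le_enorm z))//.
by rewrite ler_piMl.
Qed.

End C11.

(** * Integrals outside a shrinking ball *)

Section shrinking_hole.
Context {R : realType} {N : nat}.
Local Notation mu := (@lebesgue_rV R N.+1).

Lemma rV_set1E (x : 'rV[R]_N.+1) : [set x] = [set y : 'rV[R]_N.+1 | forall i,
  [set (x ord0 i : measurableTypeR R)] (y ord0 i)].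
Proof.
by apply/seteqP; split => [y -> //|y yx /=]; apply/rowP => i; exact: yx.
Qed.

Lemma measurable_rV_set1 (x : 'rV[R]_N.+1) : measurable [set x].
Proof.
by rewrite rV_set1E; exact: (measurable_rV_box _ _ (fun i => measurable_set1 _)).
Qed.

Lemma lebesgue_rV_set1 (x : 'rV[R]_N.+1) : mu [set x] = 0%E.
Proof.
rewrite rV_set1E (lebesgue_rV_box (fun i => measurable_set1 _)).
by rewrite big_ord_recl lebesgue_measure_set1 mul0e.
Qed.

Lemma ae_neq (x : 'rV[R]_N.+1) : {ae mu, forall y, y != x}.
Proof.
exists [set x]; split; [exact: measurable_rV_set1|exact: lebesgue_rV_set1|].
by move=> y /= /negP; rewrite negbK => /eqP.
Qed.

(** Dominated convergence along sequences of radii; the centre, where the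
    integrands do not converge to h, is a null set. *)
Lemma cvg_integral_setD_eball (x : 'rV[R]_N.+1) D (h : 'rV[R]_N.+1 -> R) :
  measurable D -> mu.-integrable D (EFin \o h) ->
  (\int[mu]_(y in D `\` eball x e) (h y)%:E)%E @[e --> 0^'+] -->
  (\int[mu]_(y in D) (h y)%:E)%E.
Proof.
move=> mD hD.
have mh : measurable_fun D (EFin \o h) by exact: measurable_int hD.
rewrite -[X in _ --> X]fineK; last exact: integrable_fin_num.
apply/cvge_at_rightP => r [r0 r_cvg].
rewrite fineK; last exact: integrable_fin_num.
under eq_fun do rewrite setDE integral_mkcondr.
have := @dominated_convergence _ _ _ mu D mD
  (fun k => (EFin \o h) \_ (~` eball x (r k))) (EFin \o h) (abse \o (EFin \o h)).
case => //.
- move=> k; apply/measurable_restrict => //.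
    by apply: measurableC; exact: measurable_eball.
  by apply: measurable_funS mh => //; exact: subIsetl.
- exists [set x]; split; [exact: measurable_rV_set1|exact: lebesgue_rV_set1|].
  move=> y /= /not_implyP[Dy]; apply: contra_notP => yx.
  apply: cvg_near_cst.
  have yx0 : 0 < enorm (y - x) by apply: enorm_sub_gt0; apply/eqP.
  apply: filterS (cvgr_lt 0 r_cvg _ yx0) => k rk.
  rewrite patchE mem_set//= /eball/=; apply/negP; rewrite -leNgt; exact: ltW.
- exact: integrable_abse.
apply: aeW => y k Dy; rewrite patchE; case: ifP => //= _.
by rewrite normr0 lee_fin.
Qed.

End shrinking_hole.

(** * Existence of the principal value *)

Section principal_value.
Context {R : realType} {N : nat}.
Local Notation mu := (@lebesgue_rV R N.+1).
Variables (s P : R) (p : 'rV[R]_N.+1 -> 'rV[R]_N.+1 -> R)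
  (v : 'rV[R]_N.+1 -> R) (x : 'rV[R]_N.+1).
Hypothesis s01 : 0 < s < 1.
Hypothesis measurable_px : measurable_fun setT (p x).
Hypothesis px_gt2 : forall y, 2 < p x y.
Hypothesis px_le : forall y, p x y <= P.
Hypothesis px_sym : forall z, p x (x + z) = p x (x - z).
Hypothesis measurable_v : measurable_fun setT v.
Hypothesis v_osc : forall y, `|v x - v y| <= 1.

(** This is convertible to the integrand of
    [frac_laplacian], rewritten with the signed power. *)
Definition pv_integrand y : R :=
  signed_powR (p x y) (v x - v y) / enorm (x - y) `^ (N.+1%:R + s * p x y).

Lemma measurable_pv_integrand : measurable_fun setT pv_integrand.
Proof.
have mv : measurable_fun setT (fun y => v x - v y) by exact: measurable_funB.
rewrite /pv_integrand; under eq_fun do rewrite -powRN.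
apply: measurable_funM.
  apply: measurable_funM => //; apply: measurable_fun_powR.
    exact: measurableT_comp.
  exact: measurable_funB.
apply: measurable_fun_powR.
  apply: continuous_measurable_rV => y.
  apply: (@continuous_comp _ _ _ (fun y : 'rV[R]_N.+1 => x - y) (@enorm R N.+1)).
    move=> /=; apply: (@continuousB _ _ _ (fun=> x) id); last exact: cvg_id.
    exact: cst_continuous.
  exact: continuous_enorm.
apply: measurableT_comp => //.
by apply: measurable_funD => //; exact: measurable_funM.
Qed.

(** The exponent 2(1-s) comes from the behaviour near x, and 2s from the decay
    at infinity; 2 is the lower bound of p. *)
Let gamma := Num.min (2 * (1 - s)) (2 * s).

Let gamma_gt0 : 0 < gamma.
Proof. by have /andP[s0 s1] := s01; rewrite lt_min !mulr_gt0 ?subr_gt0. Qed.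

Let K := @power_kernel R N.+1 gamma.

Let integrable_K (c : R) : mu.-integrable setT (fun y => (c * K (y - x))%:E).
Proof.
have iK := @integrable_power_kernel R N.+1 gamma gamma_gt0.
have mK : measurable_fun setT K by apply/measurable_EFinP; exact: measurable_int iK.
have := integrable_measure_preserving _ _ (lebesgue_rV_shift _ (- x)) _ _
  measurableT mK iK.
by rewrite preimage_setT => iK'; exact: (integrableZl measurableT c iK').
Qed.

(** Outside B(x, 1), s p >= 2s >= gamma.  Between B(x, d) and B(x, 1) the
    powers of |y-x| are comparable, which produces the constant
    d^-(gamma + sP). *)
Lemma pv_integrand_far (d : R) : 0 < d <= 1 ->
  exists2 C, 0 <= C & forall y, d <= enorm (y - x) ->
    `|pv_integrand y| <= C * K (y - x).
Proof.
move=> /andP[d0 d1].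
exists (d `^ (- (gamma + s * P))); first exact: powR_ge0.
move=> y dy; have r0 : 0 < enorm (y - x) by exact: lt_le_trans dy.
have /andP[s0 s1] := s01; have q2 := px_gt2 y; have qP := px_le y.
have gs : gamma <= 2 * s by rewrite /gamma ge_min lexx orbT.
have sq : gamma <= s * p x y.
  by rewrite (le_trans gs)// mulrC ler_wpM2l//; lra.
have num1 : `|signed_powR (p x y) (v x - v y)| <= 1.
  rewrite /signed_powR normrM mulr_ile1//.
    rewrite ger0_norm ?powR_ge0//.
    by rewrite powR_le1//; lra.
rewrite /pv_integrand enorm_distC normrM normfV [X in _ / X]ger0_norm ?powR_ge0//.
set r := enorm (y - x) in dy r0 *.
apply: (@le_trans _ _ (r `^ (- (N.+1%:R + s * p x y)))).
  by rewrite powRN ler_piMl ?invr_ge0 ?powR_ge0.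
rewrite /K /power_kernel -/r; case: ifPn => r1.
  rewrite [X in r `^ X <= _]
    (_ : _ = - (gamma + s * p x y) + (gamma - N.+1%:R)); last by ring.
  rewrite [X in X <= _]powRD; last by rewrite (gt_eqF r0) implybT.
  rewrite ler_wpM2r ?powR_ge0// !powRN lef_pV2 ?posrE ?powR_gt0//.
  apply: (@le_trans _ _ (d `^ (gamma + s * p x y))).
    by rewrite ger_powR ?d0// lerD2l ler_wpM2l//; lra.
  rewrite ge0_ler_powR ?nnegrE ?(ltW d0) ?(ltW r0)//.
  by rewrite addr_ge0 ?(ltW gamma_gt0)// (le_trans (ltW gamma_gt0)).
rewrite -leNgt in r1.
apply: (@le_trans _ _ (r `^ (- gamma - N.+1%:R))).
  by rewrite ler_powR//; lra.
rewrite ler_peMl ?powR_ge0// powRN invf_ge1 ?powR_gt0//.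
rewrite powR_le1//; first exact: ltW.
by rewrite addr_ge0// ?(ltW gamma_gt0)// mulr_ge0//; lra.
Qed.

Variables d L C : R.
Hypothesis d01 : 0 < d <= 1.
Hypothesis L_ge1 : 1 <= L.
Hypothesis C_ge0 : 0 <= C.
Hypothesis v_reg : forall z, enorm z < d ->
  `|v (x + z) - v x| <= L * enorm z /\
  `|(v (x + z) - v x) + (v (x - z) - v x)| <= C * enorm z ^+ 2.

(** The two numerators are signed powers of increments a, b with |a|, |b| at
    most L|z| and |a + b| at most C|z|^2, so that their sum is
    O(|z|^(q-2) |z|^2); after division by |z|^(N+sq), the exponent
    q(1-s) - N >= 2(1-s) - N remains. *)
Lemma pv_integrand_near z : enorm z < d ->
  `|pv_integrand (x + z) + pv_integrand (x - z)| <=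
  (P - 1) * L `^ P * C * K z.
Proof.
move=> zd; have [z1 z2] := v_reg z zd.
have [|zN1 _] := v_reg (- z); first by rewrite enormN.
rewrite enormN in zN1.
have /andP[s0 s1] := s01; have /andP[d0 d1] := d01.
have q2 := px_gt2 (x + z); have qP := px_le (x + z).
rewrite /pv_integrand -px_sym opprD addNKr enormN.
rewrite (_ : x - (x - z) = z); last by rewrite opprB addrC subrK.
rewrite -mulrDl normrM normfV [X in _ / X]ger0_norm ?powR_ge0//.
set q := p x (x + z) in q2 qP *.
have K0 : 0 <= K z by exact: power_kernel_ge0.
have C0 : 0 <= (P - 1) * L `^ P * C by rewrite !mulr_ge0 ?powR_ge0//; lra.
have [r0|] := eqVneq (enorm z) 0.
  have -> : z = 0 by exact: enorm_eq0.
  by rewrite subr0 addr0 subrr signed_powR0 addr0 normr0 mul0r mulr_ge0 ?power_kernel_ge0.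
move=> rn0; have r0 : 0 < enorm z by rewrite lt_neqAle eq_sym rn0 enorm_ge0.
set r := enorm z in zd z1 z2 zN1 rn0 r0 *.
have num : `|signed_powR q (v x - v (x + z)) + signed_powR q (v x - v (x - z))| <=
    (P - 1) * L `^ P * C * (r `^ (q - 2) * r ^+ 2).
  apply: (@le_trans _ _ ((q - 1) * (L * r) `^ (q - 2) *
      `|v x - v (x + z) + (v x - v (x - z))|)).
    by apply: signed_powR_add_le => //; rewrite distrC.
  have -> : v x - v (x + z) + (v x - v (x - z)) =
    - (v (x + z) - v x + (v (x - z) - v x)) by ring.
  rewrite normrN.
  apply: (@le_trans _ _ ((q - 1) * (L * r) `^ (q - 2) * (C * r ^+ 2))).
    by rewrite ler_wpM2l// mulr_ge0 ?powR_ge0//; lra.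
  have L0 : 0 <= L by exact: le_trans ler01 L_ge1.
  rewrite (powRM _ L0 (ltW r0)).
  rewrite [leLHS](_ : _ =
    ((q - 1) * L `^ (q - 2)) * (C * (r `^ (q - 2) * r ^+ 2))); last by ring.
  rewrite -!mulrA mulrA [leRHS]mulrA ler_wpM2r//.
    by rewrite !mulr_ge0 ?powR_ge0 ?(ltW r0).
  apply: ler_pM; rewrite ?powR_ge0//; [lra|lra|].
  by rewrite ler_powR//; lra.
apply: (@le_trans _ _ ((P - 1) * L `^ P * C * (r `^ (q - 2) * r ^+ 2) /
    r `^ (N.+1%:R + s * q))).
  by rewrite ler_wpM2r// invr_ge0 powR_ge0.
rewrite -mulrA ler_wpM2l// -powR_mulrn ?(ltW r0)// -powRN.
rewrite -!powRD ?(gt_eqF r0) ?implybT//.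
rewrite /K /power_kernel -/r (lt_le_trans zd d1).
rewrite ger_powR ?r0 ?(ltW (lt_le_trans zd d1))//.
have gs : gamma <= 2 * (1 - s) by rewrite /gamma ge_min lexx.
have : 2 * (1 - s) <= q * (1 - s) by rewrite ler_wpM2r//; lra.
lra.
Qed.

Lemma integrable_pv_integrand e : 0 < e ->
  mu.-integrable (~` eball x e) (EFin \o pv_integrand).
Proof.
move=> e0.
have e1 : 0 < Num.min 1 e <= 1 by rewrite lt_min ltr01 e0 ge_min lexx.
have [C' C'0 far] := pv_integrand_far _ e1.
have mB : measurable (~` eball x e) by apply: measurableC; exact: measurable_eball.
apply: (@le_integrable _ _ _ _ _ mB _ (fun y => (C' * K (y - x))%:E)).
- by apply: measurable_funTS; apply/measurable_EFinP; exact: measurable_pv_integrand.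
- move=> y /= /negP; rewrite -leNgt => ye.
  rewrite lee_fin [leRHS]ger0_norm; last by rewrite mulr_ge0// power_kernel_ge0.
  by apply: far; rewrite (le_trans _ ye)// ge_min lexx orbT.
- exact/(integrableS measurableT mB (@subsetT _ _))/integrable_K.
Qed.

(** The complement of B(x, e) is invariant under y |-> 2x - y, so the integral
    over it is half that of the symmetrized integrand, which is integrable on
    the whole space. *)
Lemma pv_integral_cvg : exists I : R,
  (\int[mu]_(y in ~` eball x e) (pv_integrand y)%:E)%E @[e --> 0^'+] --> I%:E.
Proof.
pose sym y := pv_integrand y + pv_integrand (2 *: x - y).
have mopp := lebesgue_rV_point_reflection _ (2 *: x).
have msym : measurable_fun setT sym.
  apply: measurable_funD; first exact: measurable_pv_integrand.
  exact: measurableT_comp measurable_pv_integrand mopp.1.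
have isym : mu.-integrable setT (EFin \o sym).
  have [C' C'0 far] := pv_integrand_far _ d01.
  pose A := Num.max ((P - 1) * L `^ P * C) (C' + C').
  apply: (@le_integrable _ _ _ mu setT measurableT (EFin \o sym)
    (fun y => (A * K (y - x))%:E)).
  - exact/measurable_EFinP.
  - move=> y _; rewrite lee_fin.
    have K0 : 0 <= K (y - x) by exact: power_kernel_ge0.
    rewrite [leRHS]ger0_norm; last first.
      by rewrite mulr_ge0// /A le_max addr_ge0 ?orbT.
    have yE : x + (y - x) = y by rewrite addrC subrK.
    have yE' : x - (y - x) = 2 *: x - y by rewrite opprB addrA scaler_nat mulr2n.
    rewrite /sym -yE' -{1}yE; have [dy|dy] := leP d (enorm (y - x)).
      rewrite (le_trans (ler_normD _ _))//.
      rewrite (@le_trans _ _ ((C' + C') * K (y - x)))//; last first.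
        by rewrite ler_wpM2r// le_max lexx orbT.
      rewrite mulrDl lerD//; first by rewrite yE far.
      have := far (x - (y - x)); rewrite addrAC subrr add0r enormN /K.
      rewrite /power_kernel enormN; exact.
    rewrite (le_trans (pv_integrand_near _ dy))// ler_wpM2r//.
    by rewrite le_max lexx.
  - exact: integrable_K.
have [J JE] : exists J : R, (\int[mu]_y (sym y)%:E = J%:E)%E.
  by exists (fine (\int[mu]_y (sym y)%:E)%E); rewrite fineK//; exact: integrable_fin_num.
have halve e : 0 < e ->
    (\int[mu]_(y in ~` eball x e) (pv_integrand y)%:E =
     (2^-1)%:E * \int[mu]_(y in ~` eball x e) (sym y)%:E)%E.
  move=> e0.
  have mB : measurable (~` eball x e) by apply: measurableC; exact: measurable_eball.
  have iB := integrable_pv_integrand _ e0.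
  have Bsym : (fun y => 2 *: x - y) @^-1` (~` eball x e) = ~` eball x e.
    apply/funext => y; rewrite /preimage/= /eball/= scaler_nat mulr2n.
    by rewrite addrAC addrK enorm_distC.
  exact: (integral_symmetrize _ _ mopp _ _ mB Bsym
    measurable_pv_integrand iB).
exists (2^-1 * J).
apply: (@cvg_trans _ (((2^-1)%:E *
  \int[mu]_(y in setT `\` eball x e) (sym y)%:E)%E @[e --> 0^'+])).
  apply: near_eq_cvg; near=> e; rewrite setTD -(halve e)//.
rewrite EFinM -JE; apply: cvgeZl => //.
exact: (cvg_integral_setD_eball x setT sym measurableT isym).
Unshelve. all: by end_near. Qed.

End principal_value.

(** * Geometry of the reflection *)

Section reflection_geometry.
Context {R : realType} {N : nat}.
Implicit Types (lambda : R) (x y z : 'rV[R]_N.+1).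

Lemma reflectionK lambda : involutive (@reflection R N lambda).
Proof.
move=> x; apply/rowP => i; rewrite !mxE eqxx.
by case: eqP => [->|//]; ring.
Qed.

Lemma reflectionD lambda x z :
  reflection lambda (x + z) = reflection lambda x + reflection 0 z.
Proof.
by apply/rowP => i; rewrite !mxE; case: eqP => // _; ring.
Qed.

Lemma reflectionB lambda x z :
  reflection lambda (x - z) = reflection lambda x - reflection 0 z.
Proof.
by apply/rowP => i; rewrite !mxE; case: eqP => // _; ring.
Qed.

Lemma enorm_reflection0 z : enorm (reflection 0 z) = enorm z.
Proof.
congr Num.sqrt; apply: eq_bigr => i _; rewrite mxE.
by case: eqP => [->|//]; ring.
Qed.

(** The squared distances differ by 4 (lambda - x_1)(lambda - y_1) > 0. *)
Lemma enorm_reflection_lt lambda x y :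
  half_space lambda x -> half_space lambda y ->
  enorm (x - y) < enorm (x - reflection lambda y).
Proof.
rewrite /half_space/= => xl yl.
have tail : \sum_(i < N) (x - y) ord0 (lift ord0 i) ^+ 2 =
    \sum_(i < N) (x - reflection lambda y) ord0 (lift ord0 i) ^+ 2.
  by apply: eq_bigr => i _; rewrite !mxE.
have head : (x - y) ord0 ord0 ^+ 2 < (x - reflection lambda y) ord0 ord0 ^+ 2.
  rewrite !mxE eqxx -subr_gt0.
  rewrite (_ : _ - _ = 4 * ((lambda - x ord0 ord0) * (lambda - y ord0 ord0))); last by ring.
  by rewrite mulr_gt0// mulr_gt0// subr_gt0.
have lt : \sum_(i < N.+1) (x - y) ord0 i ^+ 2 <
    \sum_(i < N.+1) (x - reflection lambda y) ord0 i ^+ 2.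
  by rewrite !big_ord_recl tail ltrD2r.
rewrite /enorm ltr_sqrt// (le_lt_trans _ lt)// sumr_ge0// => i _; exact: sqr_ge0.
Qed.

Lemma half_space_enorm lambda x y : half_space lambda x ->
  enorm (y - x) < lambda - x ord0 ord0 -> half_space lambda y.
Proof.
rewrite /half_space/= => xl yx.
have := le_lt_trans (coord_le_enorm (y - x) ord0) yx; rewrite !mxE.
by move=> /(le_lt_trans (ler_norm _)); rewrite ltrD2r.
Qed.

Lemma measurable_half_space lambda : measurable (@half_space R N lambda).
Proof.
rewrite (_ : half_space lambda =
    (fun x : 'rV[R]_N.+1 => x ord0 ord0 : measurableTypeR R) @^-1` `]-oo, lambda[).
  by rewrite -[X in measurable X]setTI; apply: measurable_rV_coord.
by apply/seteqP; split => x; rewrite /half_space/= in_itv.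
Qed.

Lemma lebesgue_rV_hyperplane lambda :
  measurable [set x : 'rV[R]_N.+1 | x ord0 ord0 = lambda] /\
  lebesgue_rV N.+1 [set x : 'rV[R]_N.+1 | x ord0 ord0 = lambda] = 0%E.
Proof.
pose A (i : 'I_N.+1) : set (measurableTypeR R) := if i == ord0 then [set lambda] else setT.
have mA i : measurable (A i) by rewrite /A; case: ifP => // _; exact: measurable_set1.
rewrite (_ : mkset _ = [set x : 'rV[R]_N.+1 | forall i, A i (x ord0 i)]); last first.
  apply/seteqP; split => x /= H; last by have := H ord0; rewrite /A eqxx.
  by move=> i; rewrite /A; case: eqP => // ->.
split; first exact: measurable_rV_box.
by rewrite (lebesgue_rV_box mA) big_ord_recl {1}/A eqxx lebesgue_measure_set1 mul0e.
Qed.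

End reflection_geometry.

(** * The pointwise inequality *)

Section kernel_gap.
Context {R : realType}.

(** Here q, q' are the exponents and k, k' the denominators at y and at its
    reflection.  Let X and X' be the increments of the signed powers of
    exponents q and q' from a - c to b - d, so that X'/k' <= X/k.  Then
    S = (X'/k' - X/k) + Y/k', where Y consists of increments of the signed
    power of exponent q' from b - c to a - c and from b - d to a - d.  Y is
    negative unless a = b, and in that case X/k > X'/k' unless c = d. *)
Lemma kernel_gap (k k' q q' m a b c d : R) :
  0 < k < k' -> 2 < q -> q <= q' -> 0 < m < 1 -> 1 - 1 / ln m < q ->
  0 < a < m -> 0 < b < m -> 0 < c < m -> 0 < d < m ->
  a - b <= 0 -> a - b <= c - d ->
  let S := (signed_powR q (a - c) / k - signed_powR q (b - d) / k) +
           (signed_powR q' (a - d) / k' - signed_powR q' (b - c) / k') in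
  S <= 0 /\ (S = 0 -> a = b /\ c = d).
Proof.
move=> /andP[k0 kk'] q2 qq' m01 qm.
move=> /andP[a0 am] /andP[b0 bm] /andP[c0 cm] /andP[d0 dm] ab acbd S.
have q'2 : 2 < q' by exact: lt_le_trans qq'.
have k'0 : 0 < k' by exact: lt_trans kk'.
have al : a - c <= b - d by lra.
have ac : - m < a - c by lra.
have bd : b - d < m by lra.
have gap := signed_powR_exponent _ _ _ _ _ q2 qq' m01 qm ac al bd.
pose X := signed_powR q (b - d) - signed_powR q (a - c).
pose X' := signed_powR q' (b - d) - signed_powR q' (a - c).
pose Y := signed_powR q' (a - c) - signed_powR q' (b - c) +
          (signed_powR q' (a - d) - signed_powR q' (b - d)).
have X'X : X' <= X by exact: gap.
have X0 : 0 <= X by rewrite subr_ge0 ler_signed_powR.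
have XX' : X' / k' <= X / k.
  rewrite (@le_trans _ _ (X / k'))// ?ler_wpM2r// ?invr_ge0 ?(ltW k'0)//.
  by rewrite ler_wpM2l// lef_pV2 ?posrE// ltW.
have Y0 : Y <= 0.
  have h1 : signed_powR q' (a - c) <= signed_powR q' (b - c).
    by apply: ler_signed_powR => //; lra.
  have h2 : signed_powR q' (a - d) <= signed_powR q' (b - d).
    by apply: ler_signed_powR => //; lra.
  by rewrite /Y; lra.
have SE : S = (X' / k' - X / k) + Y / k' by rewrite /S /X /X' /Y; ring.
have Yk : Y / k' <= 0 by rewrite pmulr_lle0 ?invr_gt0.
split; first by rewrite SE; lra.
rewrite SE => S0.
have abE : a = b.
  apply/eqP; rewrite eq_le -subr_le0 ab/= leNgt; apply/negP => ltab.
  have h1 : signed_powR q' (a - c) < signed_powR q' (b - c).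
    by apply: ltr_signed_powR => //; lra.
  have h2 : signed_powR q' (a - d) < signed_powR q' (b - d).
    by apply: ltr_signed_powR => //; lra.
  have Yneg : Y < 0 by rewrite /Y; lra.
  have : Y / k' < 0 by rewrite pmulr_llt0 ?invr_gt0.
  lra.
split => //; apply/eqP; rewrite eq_le; apply/andP; split; last by lra.
rewrite leNgt; apply/negP => ltdc.
have Xpos : 0 < X by rewrite subr_gt0 ltr_signed_powR//; lra.
have : X' / k' < X / k.
  rewrite (@le_lt_trans _ _ (X / k'))// ?ler_wpM2r// ?invr_ge0 ?(ltW k'0)//.
  by rewrite ltr_pM2l// ltf_pV2 ?posrE.
lra.
Qed.

End kernel_gap.

(** * Folding the principal value onto a half-space *)

Section folding.
Context {R : realType} {N : nat}.
Local Notation mu := (@lebesgue_rV R N.+1).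
Variables (lambda : R) (x : 'rV[R]_N.+1) (D : 'rV[R]_N.+1 -> R) (L : R).
Local Notation H := (@half_space R N lambda).
Local Notation rho := (@reflection R N lambda).
Hypothesis Hx : H x.
Hypothesis mD : measurable_fun setT D.
Hypothesis integrable_D : forall e, 0 < e ->
  mu.-integrable (~` eball x e) (EFin \o D).
Hypothesis D_cvg :
  (\int[mu]_(y in ~` eball x e) (D y)%:E)%E @[e --> 0^'+] --> L%:E.

Let mH : measurable H := measurable_half_space lambda.

Let rhoP := @lebesgue_rV_reflection R N lambda.

Let mrhoH : measurable (rho @^-1` H).
Proof. exact: measure_preserving_preimage rhoP _ mH. Qed.

Let rhoK_preimage : rho @^-1` (rho @^-1` H) = H.
Proof. by apply/funext => y; rewrite /preimage/= reflectionK. Qed.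

Let dist_gt0 : 0 < lambda - x ord0 ord0.
Proof. by rewrite subr_gt0. Qed.

Let mB e : measurable (eball x e).
Proof. exact: measurable_eball. Qed.

Let rhoHB e : e <= lambda - x ord0 ord0 -> rho @^-1` H `<=` ~` eball x e.
Proof.
move=> el y /= + /lt_le_trans /(_ el) /(half_space_enorm _ _ _ Hx).
rewrite /half_space/= mxE eqxx; lra.
Qed.

Let iDrhoH : mu.-integrable (rho @^-1` H) (EFin \o D).
Proof.
apply: integrableS (integrable_D _ dist_gt0) => //; first exact: measurableC.
exact: rhoHB.
Qed.

Let iDrho : mu.-integrable H (EFin \o (D \o rho)).
Proof.
have := integrable_measure_preserving _ _ rhoP _ _ mrhoH mD iDrhoH.
by rewrite rhoK_preimage.
Qed.

(** A ball around x contained in H leaves the reflected half-space untouched,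
    so the singularity appears in one of the two terms only; the hyperplane is
    a null set. *)
Let fold e : 0 < e <= lambda - x ord0 ord0 ->
  (\int[mu]_(y in ~` eball x e) (D y)%:E =
   \int[mu]_(y in H `\` eball x e) (D y)%:E + \int[mu]_(y in H) (D (rho y))%:E)%E.
Proof.
move=> /andP[e0 el].
have [mT T0] := @lebesgue_rV_hyperplane R N lambda.
set T := mkset _ in mT T0.
have iB := integrable_D _ e0.
rewrite (negligible_integral mT _ iB T0)//; last exact: measurableC.
have -> : ~` eball x e `\` T = (H `\` eball x e) `|` rho @^-1` H.
  apply/seteqP; split => y.
    move=> [yB yT]; have [yl|ly] := ltP (y ord0 ord0) lambda; first by left.
    right; rewrite /= /half_space/= mxE eqxx.
    have : y ord0 ord0 != lambda by apply/eqP.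
    by rewrite neq_lt ltNge ly/= => ?; lra.
  move=> [[yH yB]|yH]; split.
  - exact: yB.
  - by move: yH; rewrite /half_space/T/= => + yl; rewrite yl ltxx.
  - exact: rhoHB yH.
  - by move: yH; rewrite /half_space/T/= mxE eqxx => + yl; rewrite yl; lra.
rewrite integral_setU//; last 3 first.
- exact: measurableD.
- by apply: measurable_funTS; apply/measurable_EFinP.
- apply/disj_setPS => y [[]]; rewrite /= /half_space/= mxE eqxx; lra.
have := integral_measure_preserving _ _ rhoP _ _ mrhoH mD iDrhoH.
by rewrite rhoK_preimage => ->.
Qed.

Hypothesis L_ge0 : 0 <= L.
Hypothesis fold_le0 : forall y, H y -> y != x -> D y + D (rho y) <= 0.

(** The integral of S = -(D + D o rho) >= 0 over H minus B(x, e) tends to -L <= 0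
    as e tends to 0.  It increases when e decreases, so it is at most its
    limit, hence zero, for every e. *)
Lemma fold_ae_eq0 : {ae mu, forall y, H y -> D y + D (rho y) = 0}.
Proof.
pose S y := - (D y + D (rho y)).
have mS : measurable_fun setT S.
  apply: measurableT_comp => //; apply: measurable_funD => //.
  exact: measurableT_comp rhoP.1.
have iH e : 0 < e -> mu.-integrable (H `\` eball x e) (EFin \o D).
  move=> e0; apply: integrableS (integrable_D _ e0).
  - exact: measurableC.
  - exact: measurableD.
  - by move=> y [].
have iHrho e : mu.-integrable (H `\` eball x e) (EFin \o (D \o rho)).
  by apply: (integrableS mH _ _ iDrho); [exact: measurableD|move=> y []].
have SE e : 0 < e <= lambda - x ord0 ord0 ->
    (\int[mu]_(y in H `\` eball x e) (S y)%:E =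
     \int[mu]_(y in H) (D (rho y))%:E
     - \int[mu]_(y in H `\` eball x e) (D (rho y))%:E
     - \int[mu]_(y in ~` eball x e) (D y)%:E)%E.
  move=> eP; have /andP[e0 _] := eP; rewrite fold//.
  have mHB : measurable (H `\` eball x e) by exact: measurableD.
  have -> : (\int[mu]_(y in H `\` eball x e) (S y)%:E =
    - (\int[mu]_(y in H `\` eball x e) (D y)%:E +
      \int[mu]_(y in H `\` eball x e) (D (rho y))%:E))%E.
    rewrite -(integralD mHB (iH _ e0) (iHrho e)) -integralN//.
    exact: (integrable_add_def mHB (integrableD mHB (iH _ e0) (iHrho e))).
  have f1 := integrable_fin_num mHB (iH _ e0).
  have f2 := integrable_fin_num mHB (iHrho e).
  have f3 := integrable_fin_num mH iDrho.
  move: f1 f2 f3; rewrite /comp/=.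
  case: (\int[mu]_(y in _ `\` _) (D y)%:E)%E => // a _.
  case: (\int[mu]_(y in _ `\` _) (D (rho y))%:E)%E => // b _.
  case: (\int[mu]_(y in _) (D (rho y))%:E)%E => // c _.
  move=> /=; rewrite -[LHS]/(- (a + b))%:E -[RHS]/(c - b - (a + c))%:E.
  by congr EFin; ring.
have S_cvg : (\int[mu]_(y in H `\` eball x e) (S y)%:E)%E @[e --> 0^'+] --> (- L)%:E.
  have fJ := integrable_fin_num mH iDrho.
  have dJ := cvg_integral_setD_eball x _ _ mH iDrho.
  set J := (\int[mu]_(y in H) _)%E in fJ dJ *.
  have def1 : (J +? - J)%E by apply: fin_num_adde_defl; rewrite fin_numN.
  have def2 : (J - J +? - L%:E)%E by apply: fin_num_adde_defl.
  rewrite (_ : (- L)%:E = J - J - L%:E)%E; last by rewrite subee// add0e.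
  apply: (cvg_trans _ (cvgeB def2 (cvgeB def1 (cvg_cst J) dJ) D_cvg)).
  apply: near_eq_cvg; near=> e; rewrite SE//; apply/andP; split => //.
  by near: e; exact: nbhs_right_le.
have S_ge0 e y : 0 < e -> (H `\` eball x e) y -> 0 <= S y.
  move=> e0 [yH yB]; rewrite oppr_ge0 fold_le0//; apply/eqP => yx.
  by apply: yB; rewrite yx /eball/= subrr enorm0.
have S0 e : 0 < e -> (\int[mu]_(y in H `\` eball x e) (S y)%:E = 0)%E.
  move=> e0; apply/eqP; rewrite eq_le; apply/andP; split; last first.
    by apply: integral_ge0 => y Hy; rewrite lee_fin; exact: S_ge0 Hy.
  apply: (@le_trans _ _ (- L)%:E); last by rewrite lee_fin oppr_le0.
  apply: cvge_ge S_cvg; near=> e'.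
  have e'0 : 0 < e' by [].
  apply: ge0_subset_integral; try exact: measurableD.
  - by apply: measurable_funTS; exact/measurable_EFinP.
  - by move=> y Hy; rewrite lee_fin; exact: S_ge0 Hy.
  - move=> y [Hy /= yB]; split => //; apply: contra_not yB; rewrite /eball/=.
    by move=> /lt_le_trans; apply; near: e'; exact: nbhs_right_le.
have ae_k (k : nat) : {ae mu, forall y, (H `\` eball x k.+1%:R^-1) y -> S y = 0}.
  have k0 : 0 < k.+1%:R^-1 :> R by rewrite invr_gt0.
  have mHB : measurable (H `\` eball x k.+1%:R^-1) by exact: measurableD.
  have mSk : measurable_fun (H `\` eball x k.+1%:R^-1) (EFin \o S).
    by apply: measurable_funTS; exact/measurable_EFinP.
  have [+ _] := ae_eq_integral_abs mu mHB mSk.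
  rewrite (_ : (\int[mu]_(y in _) _ = 0)%E); last first.
    rewrite -(S0 _ k0); apply: eq_integral => y /set_mem Hy.
    by rewrite gee0_abs// lee_fin; exact: S_ge0 Hy.
  by move=> /(_ erefl); apply: filterS => y + Hy => /(_ Hy) [].
apply: filterS2 (ae_foralln ae_k) (ae_neq x) => y Sk yx Hy.
have yx0 := enorm_sub_gt0 _ _ yx.
have [k] := ltr_add_invr yx0; rewrite add0r => ky.
apply/eqP; rewrite -oppr_eq0; apply/eqP/(Sk k); split => //.
by rewrite /eball/=; apply/negP; rewrite -leNgt ltW.
Unshelve. all: by end_near. Qed.

End folding.

(** * Almost everywhere vanishing at a minimum *)

Section comparison.
Context {R : realType} {N : nat}.
Local Notation mu := (@lebesgue_rV R N.+1).
Variables (s m lambda : R) (p : 'rV[R]_N.+1 -> 'rV[R]_N.+1 -> R)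
  (u : 'rV[R]_N.+1 -> R).
Hypothesis s01 : 0 < s < 1.
Hypothesis hP1 : condP1 s m p.
Hypothesis hP2 : condP2 p.
Hypothesis hC11 : C11_loc u.
Hypothesis u_range : forall x, 0 < u x < m.
Local Notation H := (@half_space R N lambda).
Local Notation rho := (@reflection R N lambda).

Let p_gt2 x y : 2 < p x y.
Proof. by case: hP1. Qed.

Let m01 : 0 < m < 1.
Proof. by case: hP1. Qed.

Let p_bounded : exists P, forall x y, p x y <= P.
Proof.
case: hP1 => _ _ _ [_ [P [_ [_ pP] _ _]]].
by exists P => x y; exact: (pP (x, y)).
Qed.

Let p_gt_ln x y : 1 - 1 / ln m < p x y.
Proof.
case: hP1 => _ _ _ [Q [_ [[_ Qp] _ h _]]].
exact: lt_le_trans h (Qp (x, y)).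
Qed.

Let measurable_p x : measurable_fun setT (p x).
Proof.
case: hP1 => cp _ _ _; apply: continuous_measurable_rV => y.
apply: (@continuous2_cvg _ _ _ _ (nbhs y) _ (fun=> x) id p x y).
- exact: (cp (x, y)).
- exact: cvg_cst.
- exact: cvg_id.
Qed.

Let p_sym x z : p x (x + z) = p x (x - z).
Proof.
case: hP2 => Q [_ pQ _ _]; rewrite !pQ; congr Q.
by rewrite opprD addNKr enormN opprB addrC subrK.
Qed.

Let measurable_u : measurable_fun setT u.
Proof.
apply: continuous_measurable_rV => x; apply: differentiable_continuous.
by case: hC11.
Qed.

(** The regularity is asked at x only, so that the statement also applies to
    the reflected function, whose regularity at x is that of u at rho x. *)
Lemma frac_laplacian_cvg (v : 'rV[R]_N.+1 -> R) x :
  measurable_fun setT v -> (forall y, 0 < v y < m) ->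
  (exists d L C, [/\ 0 < d <= 1, 1 <= L, 0 <= C & forall z, enorm z < d ->
    `|v (x + z) - v x| <= L * enorm z /\
    `|(v (x + z) - v x) + (v (x - z) - v x)| <= C * enorm z ^+ 2]) ->
  [/\ measurable_fun setT (pv_integrand s p v x),
      forall e, 0 < e ->
        mu.-integrable (~` eball x e) (EFin \o pv_integrand s p v x) &
      exists2 I : R, (\int[mu]_(y in ~` eball x e)
          (pv_integrand s p v x y)%:E)%E @[e --> 0^'+] --> I%:E &
        frac_laplacian s p v x = I%:E].
Proof.
move=> mv vm [d [L [C [d01 L1 C0 reg]]]].
have [P pP] := p_bounded.
have osc y : `|v x - v y| <= 1.
  have /andP[x0 xm] := vm x; have /andP[y0 ym] := vm y; have /andP[_ m1] := m01.
  by rewrite ler_norml; apply/andP; split; lra.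
split.
- exact: measurable_pv_integrand.
- exact: (@integrable_pv_integrand R N s P p v x s01 (measurable_p x)
    (p_gt2 x) (pP x) mv osc).
have [I cI] := @pv_integral_cvg R N s P p v x s01 (measurable_p x) (p_gt2 x)
  (pP x) (p_sym x) mv osc d L C d01 L1 C0 reg.
by exists I => //; exact: (cvg_lim (@ereal_hausdorff _) cI).
Qed.

Let p_le_reflection x y : H x -> H y -> p x y <= p x (rho y).
Proof.
move=> Hx Hy; case: hP2 => Q [_ pQ Qnd _]; rewrite !pQ.
by apply: Qnd; rewrite ?in_itv/= ?andbT ?enorm_ge0// ltW// enorm_reflection_lt.
Qed.

(** r^(N+s q) = r^N (r^q)^s, where r^Q(r) is increasing in r. *)
Let denom_lt x y : H x -> H y -> y != x ->
  0 < enorm (x - y) `^ (N.+1%:R + s * p x y) <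
      enorm (x - rho y) `^ (N.+1%:R + s * p x (rho y)).
Proof.
move=> Hx Hy yx; have /andP[s0 _] := s01.
have r0 : 0 < enorm (x - y) by rewrite enorm_distC enorm_sub_gt0.
have rr' := enorm_reflection_lt _ _ _ Hx Hy.
have r'0 := lt_trans r0 rr'.
have base : enorm (x - y) `^ p x y < enorm (x - rho y) `^ p x (rho y).
  case: hP2 => Q [_ pQ _ Qincr]; rewrite !pQ.
  by apply: Qincr; rewrite ?in_itv/= ?andbT ?enorm_ge0.
rewrite powR_gt0//= !powRD ?(gt_eqF r0) ?(gt_eqF r'0) ?implybT//.
rewrite ltr_pM ?powR_ge0//.
  by rewrite gt0_ltr_powR ?nnegrE ?enorm_ge0 ?ltr0n.
by rewrite mulrC [X in _ < _ `^ X]mulrC !powRrM gt0_ltr_powR ?nnegrE ?powR_ge0.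
Qed.

(** The values of D at y and at rho y combine into the quantity of
    [kernel_gap], because u_lambda(rho y) = u(y). *)
Lemma min_reflection_diff_ae x : H x ->
  (0 <= frac_laplacian s p (reflected lambda u) x - frac_laplacian s p u x)%E ->
  reflection_diff lambda u x <= 0 ->
  (forall y, H y -> reflection_diff lambda u x <= reflection_diff lambda u y) ->
  {ae mu, forall y, H y ->
    reflection_diff lambda u x = 0 /\ reflection_diff lambda u y = 0}.
Proof.
move=> Hx lap wx0 wmin.
have mrho := (lebesgue_rV_reflection N lambda).1.
have [mf jf [I cI fI]] := frac_laplacian_cvg u x measurable_u u_range
  (C11_loc_second_difference u x hC11).
have [||mg jg [J cJ gJ]] := frac_laplacian_cvg (reflected lambda u) x
  (measurableT_comp measurable_u mrho).
- by move=> y; exact: u_range.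
- have [d [L [C [d01 L1 C0 reg]]]] := C11_loc_second_difference u (rho x) hC11.
  exists d, L, C; split => // z zd; rewrite /reflected/= reflectionD reflectionB.
  by rewrite -(enorm_reflection0 z); apply: reg; rewrite enorm_reflection0.
have IJ : 0 <= J - I by rewrite gJ fI in lap.
pose D y := pv_integrand s p (reflected lambda u) x y - pv_integrand s p u x y.
have gap y : H y -> y != x -> D y + D (rho y) <= 0 /\
    (D y + D (rho y) = 0 ->
      reflection_diff lambda u x = 0 /\ reflection_diff lambda u y = 0).
  move=> Hy yx.
  have := kernel_gap _ _ _ _ _ (u (rho x)) (u x) (u (rho y)) (u y)
    (denom_lt _ _ Hx Hy yx) (p_gt2 x y) (p_le_reflection _ _ Hx Hy) m01
    (p_gt_ln x y) (u_range _) (u_range _) (u_range _) (u_range _) wx0 (wmin _ Hy).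
  rewrite /D /pv_integrand /reflection_diff /reflected/= reflectionK.
  by move=> [S0 S1]; split => // /S1[-> ->]; rewrite !subrr.
have mD : measurable_fun setT D by exact: measurable_funB.
have jD e : 0 < e -> mu.-integrable (~` eball x e) (EFin \o D).
  move=> e0; have mB : measurable (~` eball x e).
    by apply: measurableC; exact: measurable_eball.
  exact: (integrableB mB (jg _ e0) (jf _ e0)).
have cD : (\int[mu]_(y in ~` eball x e) (D y)%:E)%E @[e --> 0^'+] --> (J - I)%:E.
  have def : (J%:E +? - I%:E)%E by [].
  rewrite EFinB; apply: (cvg_trans _ (cvgeB def cJ cI)).
  apply: near_eq_cvg; near=> e.
  have e0 : 0 < e by [].
  have mB : measurable (~` eball x e).
    by apply: measurableC; exact: measurable_eball.
  by rewrite -(integralB_EFin mB (jg _ e0) (jf _ e0)).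
have fold0 := fold_ae_eq0 lambda x D (J - I) Hx mD jD cD IJ
  (fun y Hy yx => (gap y Hy yx).1).
by apply: filterS2 fold0 (ae_neq x) => y S0 yx Hy; apply: (gap y Hy yx).2; exact: S0.
Unshelve. all: by end_near. Qed.

End comparison.

(** * Antisymmetric maximum principle *)

Section conclusion.
Context {R : realType} {N : nat}.
Local Notation mu := (@lebesgue_rV R N.+1).

(** A statement independent of y that holds at almost every point of H is true,
    as H contains a unit cube. *)
Lemma half_space_not_negligible (lambda : R) (P : Prop) :
  {ae mu, forall y, half_space lambda y -> P} -> P.
Proof.
move=> [A [mA A0 HA]]; apply: contrapT => nP.
pose I (i : 'I_N.+1) : set (measurableTypeR R) := `]lambda - 1, lambda[%classic.
have mI i : measurable (I i) by exact: measurable_itv.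
have mbox := measurable_rV_box _ I mI.
have box1 : mu [set y : 'rV[R]_N.+1 | forall i, I i (y ord0 i)] = 1%E.
  rewrite (lebesgue_rV_box mI) big1// => i _; rewrite lebesgue_measure_itv/=.
  by rewrite lte_fin ltrBlDr ltrDl ltr01 -EFinB; congr EFin; ring.
have : (mu [set y : 'rV[R]_N.+1 | forall i, I i (y ord0 i)] <= mu A)%E.
  apply: le_measure; rewrite ?inE// => y Iy; apply: HA => /= /(_ _)/nP; apply.
  by have := Iy ord0; rewrite /I/= in_itv/= => /andP[].
by rewrite box1 A0 lee_fin ler10.
Qed.

Lemma closed_half_ball_compact (lambda : R) :
  compact [set y : 'rV[R]_N.+1 | y ord0 ord0 <= lambda /\ enorm y <= 1].
Proof.
apply: bounded_closed_compact.
  exists 1; split => // M M1 y [_ y1].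
  by rewrite /= (le_trans (norm_le_enorm y))// (le_trans y1)// ltW.
apply: closedI.
  apply: (@closed_comp _ _ (fun y : 'rV[R]_N.+1 => y ord0 ord0) [set t | t <= lambda]).
    by move=> y _; exact: coord_continuous.
  exact: closed_le.
apply: (@closed_comp _ _ (@enorm R N.+1) [set t | t <= 1]).
  by move=> y _; exact: continuous_enorm.
exact: closed_le.
Qed.

Lemma continuous_reflection (lambda : R) : continuous (@reflection R N lambda).
Proof.
move=> x A /nbhs_ballP[e /= e0 eA]; apply/nbhs_ballP; exists e => // y [_ xy].
apply: eA; split=> // i j; rewrite !mxE; have := xy ord0 j; case: eqP => [->|//].
by rewrite /ball/= => h; rewrite distrC (_ : _ - _ = x ord0 ord0 - y ord0 ord0)//; ring.
Qed.

End conclusion.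

Theorem theorem3p2 (R : realType) (N : nat) (s m lambda : R)
    (p : 'rV[R]_N.+1 -> 'rV[R]_N.+1 -> R) (u : 'rV[R]_N.+1 -> R)
    (hs : 0 < s < 1)
    (hP1 : condP1 s m p)
    (hP2 : condP2 p)
    (hdom : bounded_domain (@Omega R N lambda))
    (hC11 : C11_loc u)
    (hLsp : Lsp s p u)
    (hlsc : lsc_on (closure (eball 0 1)) u)
    (hrange : forall x, 0 < u x < m)
    (hlap : forall x, eball 0 1 x ->
      (0 <= frac_laplacian s p (reflected lambda u) x - frac_laplacian s p u x)%E)
    (hext : forall x, (half_space lambda `\` eball 0 1) x ->
      0 <= reflection_diff lambda u x) :
  (forall x : 'rV[R]_N.+1, half_space lambda x -> 0 <= reflection_diff lambda u x) /\
  ((exists2 x : 'rV[R]_N.+1, Omega lambda x & reflection_diff lambda u x = 0) ->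
    {ae lebesgue_rV N.+1, forall x, reflection_diff lambda u x = 0}).
Proof.
set w := reflection_diff lambda u.
have key := @min_reflection_diff_ae R N s m lambda p u hs hP1 hP2 hC11 hrange.
have w_ge0 x : half_space lambda x -> 0 <= w x.
  move=> Hx; rewrite leNgt; apply/negP => wx.
  have ballP y : half_space lambda y -> w y < 0 -> eball 0 1 y.
    move=> Hy wy; apply: contrapT => yB.
    by have := hext y (conj Hy yB); rewrite leNgt wy.
  pose K := [set y : 'rV[R]_N.+1 | y ord0 ord0 <= lambda /\ enorm y <= 1].
  have inK y : half_space lambda y -> w y < 0 -> K y.
    move=> Hy wy; split; first exact: ltW.
    by have := ballP y Hy wy; rewrite /eball/= subr0 => /ltW.
  have cw : {within K, continuous w}.
    apply: continuous_subspaceT => y; apply: continuousB.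
      apply: continuous_comp; first exact: continuous_reflection.
      by apply: differentiable_continuous; case: hC11.
    by apply: differentiable_continuous; case: hC11.
  have [x0 /set_mem[x0l x0b] x0min] :=
    EVT_min_rV (ex_intro _ x (inK x Hx wx)) (closed_half_ball_compact lambda) cw.
  have wx0 : w x0 < 0.
    by apply: (le_lt_trans _ wx); apply: x0min; apply: mem_set; exact: inK.
  have Hx0 : half_space lambda x0.
    rewrite /half_space/= lt_neqAle x0l andbT; apply/eqP => x0E.
    suff w0 : w x0 = 0 by rewrite w0 ltxx in wx0.
    rewrite /w /reflection_diff /reflected/= (_ : reflection lambda x0 = x0) ?subrr//.
    apply/rowP => i; rewrite !mxE; case: eqP => // ->; rewrite x0E; ring.
  have x0le y : half_space lambda y -> w x0 <= w y.
    move=> Hy; have [wy|wy] := leP 0 (w y); first exact: le_trans (ltW wx0) wy.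
    by apply: x0min; apply: mem_set; exact: inK.
  have ae0 := key x0 Hx0 (hlap _ (ballP _ Hx0 wx0)) (ltW wx0) x0le.
  suff w0 : w x0 = 0 by rewrite w0 ltxx in wx0.
  apply: (half_space_not_negligible lambda).
  by apply: filterS ae0 => y h Hy; have [] := h Hy.
split=> // -[x [Hx xB] wx0].
have ae_H : {ae lebesgue_rV N.+1, forall y, half_space lambda y -> w y = 0}.
  have := key x Hx (hlap _ xB); rewrite -/w wx0 => /(_ (lexx _) w_ge0).
  by apply: filterS => y h Hy; have [] := h Hy.
have ae_rhoH : {ae lebesgue_rV N.+1, forall y, half_space lambda (reflection lambda y) ->
    w (reflection lambda y) = 0}.
  move: ae_H => [A [mA A0 HA]]; have rP := lebesgue_rV_reflection N lambda.
  exists (reflection lambda @^-1` A); split.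
  - exact: measure_preserving_preimage rP _ mA.
  - by rewrite rP.2.
  - by move=> y /= ny; apply: HA => /= h; apply: ny.
apply: filterS2 ae_H ae_rhoH => y wy wry.
have wN : w (reflection lambda y) = - w y.
  by rewrite /w /reflection_diff /reflected/= reflectionK opprB.
have [yl|yl|yl] := ltgtP (y ord0 ord0) lambda.
- exact: wy.
- apply/eqP; rewrite -oppr_eq0 -wN; apply/eqP/wry.
  by rewrite /half_space/= mxE eqxx; lra.
- rewrite /w /reflection_diff /reflected/= (_ : reflection lambda y = y) ?subrr//.
  by apply/rowP => i; rewrite !mxE; case: eqP => // ->; rewrite yl; ring.
Qed.
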